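(* Let $\mathcal T$ be a set of tile designs, with $t_{\mathrm{id}}$ tiles, for the pentagonal hexecontahedron with symmetry group the rotational icosahedral group $I$ (order $60$). Then the number of ways of tiling the faces of the pentagonal hexecontahedron up to rotational icosahedral symmetry $I$ is $$\frac{1}{60}\left(t_{\mathrm{id}}^{60}+24t_{\mathrm{id}}^{12}+20t_{\mathrm{id}}^{20}+15t_{\mathrm{id}}^{30}\right).$$
   Context: Tilings. Let $P$ be a polyhedron with set of faces $\mathcal F$ and let $\mathcal A$ be a group of isometries of $P$, acting on $\mathcal F$. A set of tile designs is a finite set $\mathcal T$ together with a group action of $\mathcal A$ on $\mathcal T\times\mathcal F$ lying over the action on $\mathcal F$ (so $A\cdot(T,F)=(T',A\cdot F)$ for some $T'\in\mathcal T$); write $t_{\mathrm{id}}=|\mathcal T|$. A tiling is a map $\tau:\mathcal F\to\mathcal T$; $\mathcal A$ acts on tilings by moving graphs: $A\cdot\tau$ is the tiling with $((A\cdot\tau)(A\cdot F),A\cdot F)=A\cdot(\tau(F),F)$ for all $F$. The number of ways of tiling up to $\mathcal A$ is the number of $\mathcal A$-orbits on the set of tilings. Polyhedron and group. Let $\phi=(1+\sqrt5)/2$, and let $I_h$ be the group of order $120$ generated by $R_0=\mathrm{diag}(-1,1,1)$, $R_2=\mathrm{diag}(1,-1,1)$ and $R_1=\frac12\begin{pmatrix}1-\phi&-\phi&-1\\-\phi&1&1-\phi\\-1&1-\phi&\phi\end{pmatrix}$. Here $\mathcal A=I=\{A\in I_h:\det A=1\}$, of order $60$. The pentagonal hexecontahedron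 is the Catalan solid dual to the snub dodecahedron, with $92$ vertices, $60$ (non-regular) pentagonal faces, and isometry group $I$. Explicitly its vertices are the $I$-orbits (of sizes $20,12,60$) of $(1,1,1)$, $\alpha(0,1,\phi)$ and $(\beta_1,\beta_2,\beta_3)$, where $\alpha\approx0.954802$ is a root of $31x^6-37x^5-42x^4+47x^3+2x^2-x-1$, $\beta_1\approx1.71556$ is a root of $x^6-4x^4-x^3+4x^2+2x-1$, $\beta_2\approx0.178737$ is a root of $x^6+x^5+12x^4-14x^3-18x^2-2x+1$, and $\beta_3\approx0.157803$ is a root of $x^6+9x^5+24x^4+12x^3-11x^2-5x+1$. The group of symmetries of a face induced by its stabilizer in $I$ is trivial. *)

(* Defs.v *)
From HB Require Import structures.
From mathcomp Require Import all_boot all_order all_algebra.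
From mathcomp Require Import ring lra.
From mathcomp Require Import boolp classical_sets functions cardinality reals.
From mathcomp Require Import convex.

Set Implicit Arguments.
Unset Strict Implicit.
Unset Printing Implicit Defensive.
Import Order.TTheory GRing.Theory Num.Theory.
Local Open Scope classical_set_scope.
Local Open Scope ring_scope.

Section Tilings.
Context {G : groupType} {F : Type}.

Record tile_designs (gact : G -> F -> F) := TileDesigns {
  tile :> finType;
  design_act : G -> tile * F -> tile * F;
  design_act1 : forall x, design_act 1%g x = x;
  design_actM : forall A B x,
    design_act (A * B)%g x = design_act A (design_act B x);
  design_act_over : forall A x, (design_act A x).2 = gact A x.2 }.

Variables (gact : G -> F -> F) (T : tile_designs gact).

Definition tiling := F -> T.

(* Characterized by tiling_actE: the graph of [tiling_act A tau] is the image
   under A of the graph of [tau]. *)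
Definition tiling_act (A : G) (tau : tiling) : tiling :=
  fun f => let f' := gact A^-1%g f in (design_act A (tau f', f')).1.

Definition tiling_orbit (tau : tiling) : set tiling :=
  [set tiling_act A tau | A in [set: G]].

Definition tiling_orbits : set (set tiling) :=
  [set tiling_orbit tau | tau in [set: tiling]].

Lemma tiling_actE (A : G) (tau : tiling) (f : F) :
  (forall f', gact 1%g f' = f') ->
  (forall B C f', gact (B * C)%g f' = gact B (gact C f')) ->
  (tiling_act A tau (gact A f), gact A f) = design_act A (tau f, f).
Proof.
move=> g1 gM; rewrite /tiling_act /= -gM mulVg g1.
by rewrite [RHS]surjective_pairing design_act_over.
Qed.

End Tilings.

Arguments tiling_orbits {G F gact} T.

Section Icosahedral.
Variable R : realType.

Definition phi : R := (1 + Num.sqrt 5) / 2.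

Definition mx3 (rows : seq (seq R)) : 'M[R]_3 :=
  \matrix_(i < 3, j < 3) nth 0 (nth [::] rows i) j.

Definition R0 : 'M[R]_3 :=
  mx3 [:: [:: -1; 0; 0];
          [::  0; 1; 0];
          [::  0; 0; 1]].

Definition R1 : 'M[R]_3 := 2^-1 *:
  mx3 [:: [:: 1 - phi;    - phi;      - 1];
          [::   - phi;        1;  1 - phi];
          [::     - 1;  1 - phi;      phi]].

Definition R2 : 'M[R]_3 :=
  mx3 [:: [:: 1;  0; 0];
          [:: 0; -1; 0];
          [:: 0;  0; 1]].

Inductive Ih : set 'M[R]_3 :=
| Ih_R0 : Ih R0
| Ih_R1 : Ih R1
| Ih_R2 : Ih R2
| Ih_one : Ih 1%:M
| Ih_mul A B : Ih A -> Ih B -> Ih (A *m B)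
| Ih_inv A : Ih A -> Ih (invmx A).

Definition rotI_set : set 'M[R]_3 := Ih `&` [set A | \det A = 1].

Definition rotI : Type := set_type rotI_set.
HB.instance Definition _ := Choice.on rotI.

Lemma rotI_unitmx (A : rotI) : val A \in unitmx.
Proof. by case: (set_valP A) => _ detA; rewrite unitmxE detA unitr1. Qed.

Fact rotI_one_subproof : 1%:M \in rotI_set.
Proof. by apply/mem_set; split; [exact: Ih_one | exact: det1]. Qed.

Fact rotI_mul_subproof (A B : rotI) : val A *m val B \in rotI_set.
Proof.
apply/mem_set; case: (set_valP A) (set_valP B) => IA dA [IB dB].
by split; [exact: Ih_mul | rewrite /= det_mulmx dA dB mulr1].
Qed.

Fact rotI_inv_subproof (A : rotI) : invmx (val A) \in rotI_set.
Proof.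
apply/mem_set; case: (set_valP A) => IA dA.
by split; [exact: Ih_inv | rewrite /= det_inv dA invr1].
Qed.

Definition rotI_one : rotI := SigSub rotI_one_subproof.
Definition rotI_mul (A B : rotI) : rotI := SigSub (rotI_mul_subproof A B).
Definition rotI_inv (A : rotI) : rotI := SigSub (rotI_inv_subproof A).

Fact rotI_mulA : associative rotI_mul.
Proof. by move=> A B C; apply: val_inj; rewrite /= mulmxA. Qed.
Fact rotI_mul1g : left_id rotI_one rotI_mul.
Proof. by move=> A; apply: val_inj; rewrite /= mul1mx. Qed.
Fact rotI_mulg1 : right_id rotI_one rotI_mul.
Proof. by move=> A; apply: val_inj; rewrite /= mulmx1. Qed.
Fact rotI_mulVg : left_inverse rotI_one rotI_inv rotI_mul.
Proof. by move=> A; apply: val_inj; rewrite /= mulVmx ?rotI_unitmx. Qed.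
Fact rotI_mulgV : right_inverse rotI_one rotI_inv rotI_mul.
Proof. by move=> A; apply: val_inj; rewrite /= mulmxV ?rotI_unitmx. Qed.

HB.instance Definition _ :=
  isGroup.Build rotI rotI_mulA rotI_mul1g rotI_mulg1 rotI_mulVg rotI_mulgV.

End Icosahedral.

Section Polyhedra.
Variable R : realType.

Definition col3 (a b c : R) : 'cV[R]_3 := \col_(i < 3) nth 0 [:: a; b; c] i.

Definition convex_hull (V : set 'cV[R]_3) : set 'cV[R]_3 :=
  smallest (@convex_set R 'cV[R]_3) V.

(* The two-dimensional faces: sections by a supporting plane that contain three
   affinely independent points. *)
Definition faces (P : set 'cV[R]_3) : set (set 'cV[R]_3) :=
  [set F | (exists (n : 'rV[R]_3) (c : R),
      [/\ n != 0,
          forall x, P x -> (n *m x) 0 0 <= c &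
          F = P `&` [set x | (n *m x) 0 0 = c]])
    /\ (exists p q r : 'cV[R]_3,
         [/\ F p, F q, F r & \rank (row_mx (q - p) (r - p)) = 2%N])].

End Polyhedra.

Section PentagonalHexecontahedron.
Variable R : realType.

(* In the next four definitions the default 0 is never used, see alphaP, ...,
   beta3P; the decimal value, split in two
   blocks of three digits, singles out one real root of the polynomial. *)
Definition is_alpha (x : R) :=
  31 * x ^+ 6 - 37 * x ^+ 5 - 42 * x ^+ 4 + 47 * x ^+ 3 + 2 * x ^+ 2 - x - 1 = 0
  /\ `|x - (954 / 10 ^+ 3 + 802 / 10 ^+ 6)| < 1 / 10 ^+ 6.
Definition alpha : R := xget 0 is_alpha.

Definition is_beta1 (x : R) :=
  x ^+ 6 - 4 * x ^+ 4 - x ^+ 3 + 4 * x ^+ 2 + 2 * x - 1 = 0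
  /\ `|x - (171 / 10 ^+ 2 + 556 / 10 ^+ 5)| < 1 / 10 ^+ 5.
Definition beta1 : R := xget 0 is_beta1.

Definition is_beta2 (x : R) :=
  x ^+ 6 + x ^+ 5 + 12 * x ^+ 4 - 14 * x ^+ 3 - 18 * x ^+ 2 - 2 * x + 1 = 0
  /\ `|x - (178 / 10 ^+ 3 + 737 / 10 ^+ 6)| < 1 / 10 ^+ 6.
Definition beta2 : R := xget 0 is_beta2.

Definition is_beta3 (x : R) :=
  x ^+ 6 + 9 * x ^+ 5 + 24 * x ^+ 4 + 12 * x ^+ 3 - 11 * x ^+ 2 - 5 * x + 1 = 0
  /\ `|x - (157 / 10 ^+ 3 + 803 / 10 ^+ 6)| < 1 / 10 ^+ 6.
Definition beta3 : R := xget 0 is_beta3.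

Lemma Poly_ivt (s : seq R) (a b : R) : a <= b ->
    (Poly s).[a] * (Poly s).[b] < 0 ->
  exists x, (Poly s).[x] = 0 /\ a < x < b.
Proof.
move=> ab sab.
have aux (p : {poly R}) : p.[a] < 0 -> 0 < p.[b] ->
    exists x, p.[x] = 0 /\ a < x < b.
  move=> pa pb; have [|x /andP[ax xb] /eqP px] := @poly_ivt R p a b ab.
    by rewrite (ltW pa) (ltW pb).
  exists x; split=> //; rewrite !lt_neqAle ax xb !andbT.
  by apply/andP; split; apply/eqP => E; move: px pa pb;
    [rewrite -E | rewrite E]; lra.
have [pa|pa|pa] := ltgtP (Poly s).[a] 0.
- by apply: aux => //; nra.
- have [||x [px xab]] := aux (- Poly s); rewrite ?hornerN; [lra|nra|].
  by exists x; split=> //; move: px; rewrite hornerN; lra.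
- by move: sab; rewrite pa mul0r ltxx.
Qed.

Lemma alphaP : is_alpha alpha.
Proof.
apply: xgetPex.
have [||x [+ xab]] := @Poly_ivt [:: -1; -1; 2; 47; -42; -37; 31]
  (954 / 10 ^+ 3 + 801 / 10 ^+ 6) (954 / 10 ^+ 3 + 803 / 10 ^+ 6).
- lra.
- rewrite !horner_Poly /=; lra.
rewrite horner_Poly /= => px; exists x; split; first lra.
by rewrite ltr_norml; lra.
Qed.

Lemma beta1P : is_beta1 beta1.
Proof.
apply: xgetPex.
have [||x [+ xab]] := @Poly_ivt [:: -1; 2; 4; -1; -4; 0; 1]
  (171 / 10 ^+ 2 + 555 / 10 ^+ 5) (171 / 10 ^+ 2 + 557 / 10 ^+ 5).
- lra.
- rewrite !horner_Poly /=; lra.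
rewrite horner_Poly /= => px; exists x; split; first lra.
by rewrite ltr_norml; lra.
Qed.

Lemma beta2P : is_beta2 beta2.
Proof.
apply: xgetPex.
have [||x [+ xab]] := @Poly_ivt [:: 1; -2; -18; -14; 12; 1; 1]
  (178 / 10 ^+ 3 + 736 / 10 ^+ 6) (178 / 10 ^+ 3 + 738 / 10 ^+ 6).
- lra.
- rewrite !horner_Poly /=; lra.
rewrite horner_Poly /= => px; exists x; split; first lra.
by rewrite ltr_norml; lra.
Qed.

Lemma beta3P : is_beta3 beta3.
Proof.
apply: xgetPex.
have [||x [+ xab]] := @Poly_ivt [:: 1; -5; -11; 12; 24; 9; 1]
  (157 / 10 ^+ 3 + 802 / 10 ^+ 6) (157 / 10 ^+ 3 + 804 / 10 ^+ 6).
- lra.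
- rewrite !horner_Poly /=; lra.
rewrite horner_Poly /= => px; exists x; split; first lra.
by rewrite ltr_norml; lra.
Qed.

Definition rotI_orbit (v : 'cV[R]_3) : set 'cV[R]_3 :=
  [set val A *m v | A in [set: rotI R]].

Definition hexecontahedron_vertices : set 'cV[R]_3 :=
  rotI_orbit (col3 1 1 1) `|` rotI_orbit (alpha *: col3 0 1 (phi R))
  `|` rotI_orbit (col3 beta1 beta2 beta3).

Definition pentagonal_hexecontahedron : set 'cV[R]_3 :=
  convex_hull hexecontahedron_vertices.

Lemma hexecontahedron_stable (A : rotI R) (x : 'cV[R]_3) :
  pentagonal_hexecontahedron x -> pentagonal_hexecontahedron (val A *m x).
Proof.
pose P := [set y : 'cV[R]_3 | pentagonal_hexecontahedron (val A *m y)].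
suff: pentagonal_hexecontahedron `<=` P by apply.
apply: smallest_sub.
  move=> y z l /set_mem Py /set_mem Pz; apply/mem_set => B /= [cB VB].
  have /set_mem := cB _ _ l (mem_set (Py B (conj cB VB)))
                            (mem_set (Pz B (conj cB VB))).
  suff -> : convex.conv l (val A *m y : convex_lmodType _) (val A *m z) =
      val A *m (convex.conv l (y : convex_lmodType _) z : 'cV[R]_3) by [].
  by rewrite /convex.conv /= mulmxDr -!scalemxAr.
have stab v w : rotI_orbit v w -> rotI_orbit v (val A *m w).
  by move=> [B _ <-]; exists (A * B)%g => //; rewrite mulmxA.
move=> y Vy; apply: sub_gen_smallest.
case: Vy => [[/stab|/stab]|/stab] Vy.
- left; left; exact: Vy.
- left; right; exact: Vy.
- right; exact: Vy.
Qed.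

Definition face : Type := set_type (faces pentagonal_hexecontahedron).

Fact face_act_subproof (A : rotI R) (F : face) :
  [set val A *m x | x in val F] \in faces pentagonal_hexecontahedron.
Proof.
have uA := rotI_unitmx A.
apply/mem_set; case: (set_valP F) => -[n [c [n0 nP ->]]].
move=> [p [q [r [Fp Fq Fr rk]]]]; split; last first.
  exists (val A *m p), (val A *m q), (val A *m r).
  split; [by exists p | by exists q | by exists r |].
  rewrite -!mulmxBr -mul_mx_row -[RHS]rk -mxrank_tr trmx_mul.
  rewrite mxrankMfree ?mxrank_tr//.
  by rewrite row_free_unit unitmx_tr.
exists (n *m invmx (val A)), c.
have AE x : val (A^-1)%g *m x = invmx (val A) *m x by [].
split.
- apply: contra n0 => /eqP nA; rewrite -[n](mulmxKV uA) nA.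
  by rewrite mul0mx.
- by move=> x /(hexecontahedron_stable A^-1%g)/nP; rewrite AE mulmxA.
apply/seteqP; split=> x /=.
  move=> [y [Py ny] <-]; split; first exact: hexecontahedron_stable.
  by rewrite -mulmxA mulKmx.
move=> [Px nx]; exists (invmx (val A) *m x); last by rewrite mulKVmx.
by split; [rewrite -AE; exact: hexecontahedron_stable | rewrite /= mulmxA].
Qed.

Definition face_act (A : rotI R) (F : face) : face :=
  SigSub (face_act_subproof A F).

Lemma face_act1 (F : face) : face_act 1%g F = F.
Proof.
apply: val_inj; apply/seteqP; split=> x /=.
  by move=> [y Fy <-]; rewrite mul1mx.
by move=> Fx; exists x => //; rewrite mul1mx.
Qed.

Lemma face_actM (A B : rotI R) (F : face) :
  face_act (A * B)%g F = face_act A (face_act B F).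
Proof.
apply: val_inj; apply/seteqP; split=> x /=.
  by move=> [y Fy <-]; exists (val B *m y); [exists y | rewrite mulmxA].
by move=> [_ [y Fy <-] <-]; exists y => //; rewrite mulmxA.
Qed.

End PentagonalHexecontahedron.

(* Main.v *)
Require Import Defs.
From HB Require Import structures.
From Stdlib Require Import ZArith Lia.
From mathcomp Require Import all_boot all_order all_algebra all_fingroup.
From mathcomp Require Import ssrZ zify ring lra.
From mathcomp Require Import boolp classical_sets functions cardinality reals.
From mathcomp Require Import convex interval_inference cyclic.

(** Let I be the rotation group, of order 60, and f0 a face.  The heart of the
    matter is that I permutes the faces simply transitively.  Granting this, a
    tiling tau is the same thing as its pattern, the function from I to tiles
    that sends A to the tile of A^-1 . tau on f0: the design action carries
    the tile on any face back to f0 in exactly one way, so every function is a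
    pattern, and acting on tau translates its pattern.  However the tile
    designs are twisted by the action, the tilings up to I are therefore the
    functions on I up to translation ([card_regular_tiling_orbits]).  A
    rotation of order k fixes the functions that are constant on the cosets of
    the subgroup that it generates, t ^ (60 / k) of them, and the
    Cauchy-Frobenius formula concludes, since I has 1, 15, 20 and 24 elements
    of orders 1, 2, 3 and 5.

    Simple transitivity is a property of the convex hull of 92 explicit
    points.  Their coordinates all lie in the sextic field Q(xi), where
    xi = beta1: one has phi = xi^3 - 2 xi, and beta2, beta3 and 31 alpha
    belong to Z[xi].  So an equality between coordinates is an identity
    between integer vectors, an inequality follows from a rational enclosure
    of xi ([ev_gt0]), and each of the finitely many checks below is a
    computation with integers.

    The group is brought into this arithmetic by measuring points against the
    simple roots of the reflection group H3: in these coordinates the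
    reflections R0, R1, R2 have entries in Z[phi], and sixty products of them
    form a list that is stable, up to sign, under multiplication by the three
    reflections ([rotI_rots]).

    Let n . x = c be the plane of one face.  A point x whose height n . x is
    maximal in its orbit satisfies n . x >= n . (A x) in particular for the
    five rotations A that carry the face to its neighbours; these five
    inequalities bound the cone over the face, because each side plane of the
    cone is the bisector of two adjacent faces ([face_cone]).  As I is finite,
    every point can be rotated to maximal height, so the hull consists of the
    points x with n . (A x) <= c for all A ([hull_radial]).  If a supporting
    plane contains three points that are not collinear, their centroid is on
    the boundary, so some rotation brings it to height c; the three points,
    none of which can be higher, follow, and the supporting plane is a
    rotated copy of the first ([face_orbit]).  Finally each rotation other
    than the identity moves a vertex of the face off its plane
    ([face_act_free]). *)

Set Implicit Arguments.
Unset Strict Implicit.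
Unset Printing Implicit Defensive.
Import Order.TTheory GRing.Theory Num.Theory.
Delimit Scope Z_scope with bZ.
Local Open Scope ring_scope.

(** * Exact arithmetic in the ring Z[xi], where xi is beta1 *)

(** The coefficients of 1, xi, ..., xi^5.  As xi is an algebraic integer of
    degree 6, this representation is unique and all operations stay in it. *)
Definition zxi : Type := (Z * Z * Z * Z * Z * Z)%type.

HB.instance Definition _ := Equality.copy zxi (Z * Z * Z * Z * Z * Z)%type.

Definition xadd (x y : zxi) : zxi :=
  let '(a0, a1, a2, a3, a4, a5) := x in let '(b0, b1, b2, b3, b4, b5) := y in
  (a0 + b0, a1 + b1, a2 + b2, a3 + b3, a4 + b4, a5 + b5)%bZ.

Definition xscale (k : Z) (x : zxi) : zxi :=
  let '(a0, a1, a2, a3, a4, a5) := x in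
  (k * a0, k * a1, k * a2, k * a3, k * a4, k * a5)%bZ.

Definition xsub x y := xadd x (xscale (-1)%bZ y).

(** Reduction by xi^6 = 4 xi^4 + xi^3 - 4 xi^2 - 2 xi + 1. *)
Definition xmulxi (x : zxi) : zxi :=
  let '(a0, a1, a2, a3, a4, a5) := x in
  (a5, a0 - 2 * a5, a1 - 4 * a5, a2 + a5, a3 + 4 * a5, a4)%bZ.

Definition xmul (x y : zxi) : zxi :=
  let '(a0, a1, a2, a3, a4, a5) := x in
  xadd (xscale a0 y) (xmulxi (xadd (xscale a1 y) (xmulxi (xadd (xscale a2 y)
  (xmulxi (xadd (xscale a3 y) (xmulxi (xadd (xscale a4 y)
  (xmulxi (xscale a5 y)))))))))).

(** A sufficient test for positivity: 10^20 times the lower bound that results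
    from 1.7155 < xi < 1.7156 by estimating each monomial separately. *)
Definition xpos (x : zxi) : bool :=
  let '(a0, a1, a2, a3, a4, a5) := x in
  let lo (a : Z) (i : Z) :=
    (a * (if 0 <=? a then 17155 else 17156) ^ i * 10000 ^ (5 - i))%bZ in
  (0 <? lo a0 0 + lo a1 1 + lo a2 2 + lo a3 3 + lo a4 4 + lo a5 5)%bZ.

Arguments xadd : simpl never.
Arguments xscale : simpl never.
Arguments xsub : simpl never.
Arguments xmulxi : simpl never.
Arguments xmul : simpl never.

Section Ev.
Variable R : realType.

Definition zr (z : Z) : R := (int_of_Z z)%:~R.
Lemma zrD a b : zr (a + b)%bZ = zr a + zr b.
Proof. by rewrite /zr rmorphD rmorphD. Qed.
Lemma zrM a b : zr (a * b)%bZ = zr a * zr b.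
Proof. by rewrite /zr rmorphM rmorphM. Qed.
Lemma zrN a : zr (- a)%bZ = - zr a.
Proof. by rewrite /zr rmorphN rmorphN. Qed.

Local Notation xi := (beta1 R).
Definition ev (x : zxi) : R :=
  let '(a0, a1, a2, a3, a4, a5) := x in
  zr a0 + xi * (zr a1 + xi * (zr a2 + xi * (zr a3 + xi * (zr a4 + xi * zr a5)))).

Arguments ev : simpl never.

Lemma ev_add x y : ev (xadd x y) = ev x + ev y.
Proof.
case: x => [[[[[a0 a1] a2] a3] a4] a5]; case: y => [[[[[b0 b1] b2] b3] b4] b5].
rewrite /ev /xadd !zrD. ring.
Qed.
Lemma ev_scale k x : ev (xscale k x) = zr k * ev x.
Proof.
case: x => [[[[[a0 a1] a2] a3] a4] a5].
rewrite /ev /xscale !zrM. ring.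
Qed.
Lemma ev_sub x y : ev (xsub x y) = ev x - ev y.
Proof. by rewrite /xsub ev_add ev_scale mulN1r. Qed.
Lemma ev_mulxi x : ev (xmulxi x) = xi * ev x.
Proof.
case: x => [[[[[a0 a1] a2] a3] a4] a5].
have [E _] := beta1P R.
rewrite /ev /xmulxi !zrD ?zrN !zrM.
have -> : zr 4%bZ = 4 by [].
have -> : zr 2%bZ = 2 by [].
apply/eqP; rewrite -subr_eq0; apply/eqP.
(* The two sides differ by a5 times the minimal polynomial of xi. *)
rewrite -[RHS](mulr0 (- zr a5)) -[in RHS]E; ring.
Qed.

Lemma ev_mul x y : ev (xmul x y) = ev x * ev y.
Proof.
case: x => [[[[[a0 a1] a2] a3] a4] a5].
rewrite /xmul !(ev_add, ev_mulxi, ev_scale) /ev. ring.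
Qed.

Lemma zr_ge0 z : (0 <=? z)%bZ -> 0 <= zr z.
Proof. by rewrite /zr ler0z; lia. Qed.
Lemma zr_lt0 z : (0 <=? z)%bZ = false -> zr z < 0.
Proof. by rewrite /zr ltrz0; lia. Qed.
Lemma zr_gt0 z : (0 <? z)%bZ -> 0 < zr z.
Proof. by rewrite /zr ltr0z; lia. Qed.

Lemma zr_pow z n : zr (z ^ Z.of_nat n)%bZ = zr z ^+ n.
Proof.
elim: n => [|n IHn]; first by rewrite expr0.
by rewrite Nat2Z.inj_succ Z.pow_succ_r ?zrM ?IHn ?exprS //; lia.
Qed.

Lemma xpos_bound (a : Z) (i : nat) : (i <= 5)%N ->
  zr (a * (if 0 <=? a then 17155 else 17156) ^ Z.of_nat i
        * 10000 ^ (5 - Z.of_nat i))%bZ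
    <= zr a * xi ^+ i * zr 10000 ^+ 5.
Proof.
move=> i5; have -> : (5 - Z.of_nat i)%bZ = Z.of_nat (5 - i) by lia.
rewrite -[in X in _ <= X](subnKC i5) !zrM !zr_pow (fun_if zr) exprD -!mulrA.
rewrite [X in _ <= _ * X]mulrA.
have [_] := beta1P R; rewrite ltr_norml => /andP[xl xu].
(* The large numerals are split, so as never to be unfolded in unary. *)
have Ed : zr 10000 = zr 100 * zr 100 by rewrite -zrM.
have El : zr 17155 = zr 171 * zr 100 + zr 55 by rewrite -zrM -zrD.
have Eu : zr 17156 = zr 171 * zr 100 + zr 56 by rewrite -zrM -zrD.
have z100 : zr 100 = 100 by [].
have z171 : zr 171 = 171 by [].
have z55 : zr 55 = 55 by [].
have z56 : zr 56 = 56 by [].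
move: (zr 17155) (zr 17156) (zr 10000) Ed El Eu.
rewrite z100 z171 z55 z56 => L U D Ed El Eu {z100 z171 z55 z56}.
have l0 : 0 <= L by rewrite El; lra.
have lo : L <= xi * D by rewrite El Ed; lra.
have hi : xi * D <= U by rewrite Eu Ed; lra.
have p0 : 0 <= D ^+ (5 - i) by rewrite exprn_ge0 // Ed; lra.
have x0 := le_trans l0 lo; have U0 := le_trans x0 hi.
rewrite -exprMn; case: ifP => [/zr_ge0|/zr_lt0/ltW] a0.
  by apply: (ler_wpM2l a0); apply: (ler_wpM2r p0); apply: lerXn2r; rewrite ?nnegrE.
by apply: (ler_wnM2l a0); apply: (ler_wpM2r p0); apply: lerXn2r; rewrite ?nnegrE.
Qed.

Lemma ev_gt0 x : xpos x -> 0 < ev x.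
Proof.
case: x => [[[[[a0 a1] a2] a3] a4] a5] /zr_gt0.
rewrite !zrD => h.
have H : 0 < zr 10000 ^+ 5 by apply: exprn_gt0; exact: zr_gt0.
rewrite -(pmulr_lgt0 _ H).
have h0 := @xpos_bound a0 0 isT; have h1 := @xpos_bound a1 1 isT.
have h2 := @xpos_bound a2 2 isT; have h3 := @xpos_bound a3 3 isT.
have h4 := @xpos_bound a4 4 isT; have h5 := @xpos_bound a5 5 isT.
apply: lt_le_trans h _.
apply: le_trans (lerD (lerD (lerD (lerD (lerD h0 h1) h2) h3) h4) h5) _.
by rewrite /ev le_eqVlt; apply/orP; left; apply/eqP; ring.
Qed.
End Ev.
Arguments ev : simpl never.

Definition xconst (z : Z) : zxi := (z, 0, 0, 0, 0, 0)%bZ.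
Arguments xconst : simpl never.

(** * The coordinates of the vertices belong to Q(xi) *)

Section Roots.
Variable R : realType.

Lemma ev_const z : ev R (xconst z) = zr R z.
Proof. by rewrite /ev /xconst (_ : zr R 0 = 0) // !(mulr0, addr0). Qed.

(** The value at x / d of the polynomial with coefficients s, cleared of its
    denominator. *)
Fixpoint xhorner (d : Z) (s : seq Z) (x : zxi) : zxi :=
  if s is a :: s' then
    xadd (xconst (a * d ^ Z.of_nat (size s'))%bZ) (xmul x (xhorner d s' x))
  else xconst 0.

Lemma ev_horner d s x : zr R d != 0 ->
  ev R (xhorner d s x)
    = zr R d ^+ (size s).-1 * (Poly (map (zr R) s)).[ev R x / zr R d].
Proof.
move=> d0; rewrite horner_Poly; elim: s => [|a s IHs] /=.
  by rewrite ev_const mulr0.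
rewrite ev_add ev_mul ev_const IHs zrM zr_pow.
case: s {IHs} => [|b s] /=; first by ring.
by rewrite !exprS; field.
Qed.

(** The difference p(x) - p(y) is x - y times a sum of i p_i t_(i-1), where
    t_i is the mean of the x^(i-j) y^j and so lies between a^i and b^i.  A
    slope that cannot vanish for any such t makes p injective, with no
    appeal to its derivative. *)
Lemma horner_inj_in (s : seq R) (a b x y : R) : 0 <= a ->
    a <= x <= b -> a <= y <= b ->
    (forall t : nat -> R, (forall i, a ^+ i <= t i <= b ^+ i) ->
       \sum_(i < (size s).-1) s`_i.+1 * i.+1%:R * t i != 0) ->
  (Poly s).[x] = (Poly s).[y] -> x = y.
Proof.
move=> a0 /andP[ax xb] /andP[ay yb] slope.
have H (w : R) : (Poly s).[w] = \sum_(i < size s) s`_i * w ^+ i.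
  rewrite (@horner_coef_wide _ (size s)) ?size_Poly //.
  by apply: eq_bigr => i _; rewrite coef_Poly.
pose t i := (\sum_(j < i.+1) x ^+ (i - j) * y ^+ j) / i.+1%:R.
have le_t i : a ^+ i <= t i <= b ^+ i.
  rewrite ler_pdivlMr ?ltr0n // ler_pdivrMr ?ltr0n // !mulr_natr.
  rewrite -[X in a ^+ i *+ X]card_ord -[X in b ^+ i *+ X]card_ord -!sumr_const.
  have x0 := le_trans a0 ax; have y0 := le_trans a0 ay.
  have b0 := le_trans x0 xb.
  have split (j : 'I_i.+1) (z : R) : z ^+ i = z ^+ (i - j) * z ^+ j.
    by rewrite -exprD subnK // -ltnS.
  by apply/andP; split; apply: ler_sum => j _; rewrite 1?(split j a) 1?(split j b);
    apply: ler_pM; rewrite ?exprn_ge0 //; apply: lerXn2r; rewrite ?nnegrE.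
move/eqP; rewrite -subr_eq0 !H -sumrB => /eqP E.
apply/eqP; rewrite -subr_eq0; move: (slope t le_t); apply: contraNT => xy.
rewrite -(mulrI_eq0 _ (lregP xy)) mulr_sumr; move: E.
case: s {slope H} => [|c s] /=; first by rewrite !big_ord0 eqxx.
rewrite big_ord_recl /= !expr0 subrr add0r => E; apply/eqP; rewrite -[RHS]E.
apply: eq_bigr => i _; rewrite /bump add1n -mulrBr subrXX.
have -> : \sum_(j < i.+1) x ^+ (i.+1.-1 - j) * y ^+ j = t i * i.+1%:R.
  by rewrite /t divfK ?pnatr_eq0.
by move: (t i) => ti; ring.
Qed.

(** Identifies a real root x, known by a polynomial and an enclosure, with an
    element c / d of Q(xi): it suffices that c / d be a root in an interval
    where the polynomial is injective. *)
Lemma eq_root_ev (d l h : Z) (s : seq Z) (c : zxi) (x : R) :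
    (0 <? d)%bZ -> (0 <=? l)%bZ -> xhorner d s c = xconst 0 ->
    xpos (xsub (xscale 100%bZ c) (xconst (d * l)%bZ)) ->
    xpos (xsub (xconst (d * h)%bZ) (xscale 100%bZ c)) ->
    zr R l / 100 <= x <= zr R h / 100 ->
    (forall t : nat -> R,
      (forall i, (zr R l / 100) ^+ i <= t i <= (zr R h / 100) ^+ i) ->
      \sum_(i < (size s).-1) (map (zr R) s)`_i.+1 * i.+1%:R * t i != 0) ->
  (Poly (map (zr R) s)).[x] = 0 -> x = ev R c / zr R d.
Proof.
move=> /(zr_gt0 R) d0 /(zr_ge0 R) l0 cs lc hc lxh slope xs.
have z100 : zr R 100 = 100 by [].
apply: (horner_inj_in _ lxh _ _ (etrans xs _)); first by rewrite divr_ge0.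
- move: (ev_gt0 R lc) (ev_gt0 R hc).
  rewrite !ev_sub !ev_scale !ev_const !zrM z100 !subr_gt0 => {}lc {}hc.
  rewrite ler_pdivlMr // ler_pdivrMr // mulrAC ler_pdivrMr //.
  rewrite mulrAC ler_pdivlMr // ![ev R c * _]mulrC !(mulrC (zr R d)) in lc hc *.
  by lra.
- by move=> t; rewrite size_map; apply: slope.
have := ev_horner s c (lt0r_neq0 d0); rewrite cs ev_const => /esym/eqP.
by rewrite mulf_eq0 expf_eq0 (gt_eqF d0) andbF => /eqP.
Qed.

Lemma beta2E : beta2 R = ev R (0, 5, 2, -7, -1, 2)%bZ.
Proof.
have [E] := beta2P R; rewrite ltr_norml => near.
rewrite (@eq_root_ev 1 15 21 [:: 1; -2; -18; -14; 12; 1; 1]%bZ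
  (0, 5, 2, -7, -1, 2)%bZ (beta2 R)) //.
- by rewrite divr1.
- lra.
- move=> t lt_t; move: (lt_t 0) (lt_t 1) (lt_t 2) (lt_t 3) (lt_t 4) (lt_t 5).
  by rewrite !big_ord_recr big_ord0 /=; lra.
by rewrite horner_Poly /=; lra.
Qed.

Lemma beta3E : beta3 R = ev R (-1, 2, -2, -1, 1, 0)%bZ.
Proof.
have [E] := beta3P R; rewrite ltr_norml => near.
rewrite (@eq_root_ev 1 15 17 [:: 1; -5; -11; 12; 24; 9; 1]%bZ
  (-1, 2, -2, -1, 1, 0)%bZ (beta3 R)) //.
- by rewrite divr1.
- lra.
- move=> t lt_t; move: (lt_t 0) (lt_t 1) (lt_t 2) (lt_t 3) (lt_t 4) (lt_t 5).
  by rewrite !big_ord_recr big_ord0 /=; lra.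
by rewrite horner_Poly /=; lra.
Qed.

Definition alpha31 : zxi := (14, 4, -38, -33, 16, 10)%bZ.

Lemma alphaE : alpha R = ev R alpha31 / zr R 31.
Proof.
have [E] := alphaP R; rewrite ltr_norml => near.
rewrite (@eq_root_ev 31 95 96 [:: -1; -1; 2; 47; -42; -37; 31]%bZ
  alpha31 (alpha R)) //.
- lra.
- move=> t lt_t; move: (lt_t 0) (lt_t 1) (lt_t 2) (lt_t 3) (lt_t 4) (lt_t 5).
  by rewrite !big_ord_recr big_ord0 /=; lra.
by rewrite horner_Poly /=; lra.
Qed.

(** The golden ratio. *)
Definition tau : zxi := (0, -2, 0, 1, 0, 0)%bZ.

Lemma phiE : phi R = ev R tau.
Proof.
pose c := tau; rewrite -/c.
have := ev_mul R c c; have := ev_add R c (xconst 1).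
rewrite (_ : xadd c (xconst 1) = xmul c c) // ev_const => -> c2.
have : 0 < ev R (xsub (xscale 2%bZ c) (xconst 1)) by exact: ev_gt0.
rewrite ev_sub ev_scale ev_const (_ : zr R 2 = 2) // => c0.
rewrite /phi (_ : 5 = (2 * ev R c - 1) ^+ 2).
  by rewrite sqrtr_sqr ger0_norm ?(ltW c0) //; lra.
have -> : (2 * ev R c - 1) ^+ 2 = 4 * (ev R c * ev R c) - 4 * ev R c + 1 by ring.
by rewrite -c2 (_ : zr R 1 = 1) //; lra.
Qed.
End Roots.

(** * Vectors and matrices over Z[xi] *)

Definition vec : Type := (zxi * zxi * zxi)%type.
HB.instance Definition _ := Equality.copy vec (zxi * zxi * zxi)%type.

(** The three rows. *)
Definition mat : Type := (vec * vec * vec)%type.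
HB.instance Definition _ := Equality.copy mat (vec * vec * vec)%type.

Definition dot (u v : vec) : zxi :=
  let '(u0, u1, u2) := u in let '(v0, v1, v2) := v in
  xadd (xmul u0 v0) (xadd (xmul u1 v1) (xmul u2 v2)).

Definition addv (u v : vec) : vec :=
  let '(u0, u1, u2) := u in let '(v0, v1, v2) := v in
  (xadd u0 v0, xadd u1 v1, xadd u2 v2).

Definition scalev (k : zxi) (v : vec) : vec :=
  let '(v0, v1, v2) := v in (xmul k v0, xmul k v1, xmul k v2).

Definition subv (u v : vec) : vec :=
  let '(u0, u1, u2) := u in let '(v0, v1, v2) := v in
  (xsub u0 v0, xsub u1 v1, xsub u2 v2).

Definition cross (u v : vec) : vec :=
  let '(u0, u1, u2) := u in let '(v0, v1, v2) := v in
  (xsub (xmul u1 v2) (xmul u2 v1), xsub (xmul u2 v0) (xmul u0 v2),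
   xsub (xmul u0 v1) (xmul u1 v0)).

Definition mulmv (M : mat) (v : vec) : vec :=
  let '(r0, r1, r2) := M in (dot r0 v, dot r1 v, dot r2 v).

Definition trm (M : mat) : mat :=
  let '((a00, a01, a02), (a10, a11, a12), (a20, a21, a22)) := M in
  ((a00, a10, a20), (a01, a11, a21), (a02, a12, a22)).

Definition mulvm (u : vec) (M : mat) : vec := mulmv (trm M) u.

Definition mulm (M N : mat) : mat :=
  let '(r0, r1, r2) := M in (mulvm r0 N, mulvm r1 N, mulvm r2 N).

Definition scalem (k : Z) (M : mat) : mat :=
  let sv v :=
    let '(v0, v1, v2) := v in (xscale k v0, xscale k v1, xscale k v2) in
  let '(r0, r1, r2) := M in (sv r0, sv r1, sv r2).

Section EvMat.
Variable R : realType.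
Local Notation ev := (ev R).

Definition evv (v : vec) : 'cV[R]_3 :=
  let '(v0, v1, v2) := v in col3 (ev v0) (ev v1) (ev v2).

Definition evm (M : mat) : 'M[R]_3 :=
  let '(r0, r1, r2) := M in
  let l v := let '(v0, v1, v2) := v in [:: ev v0; ev v1; ev v2] in
  mx3 [:: l r0; l r1; l r2].

Lemma ev_dot u v : ev (dot u v) = ((evv u)^T *m evv v) 0 0.
Proof.
case: u v => [[u0 u1] u2] [[v0 v1] v2].
by rewrite !mxE !big_ord_recl big_ord0 !mxE /= !ev_add !ev_mul addr0.
Qed.

Lemma evm_tr M : evm (trm M) = (evm M)^T.
Proof.
case: M => [[[[a00 a01] a02] [[a10 a11] a12]] [[a20 a21] a22]].
by apply/matrixP => -[[|[|[|i]]] hi] [[|[|[|j]]] hj]; rewrite !mxE.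
Qed.

Lemma evv_mulmv M v : evv (mulmv M v) = evm M *m evv v.
Proof.
case: M v => [[[[a00 a01] a02] [[a10 a11] a12]] [[a20 a21] a22]] [[v0 v1] v2].
apply/matrixP => -[[|[|[|i]]] hi] j //;
  by rewrite !mxE !big_ord_recl big_ord0 !mxE /= !ev_add !ev_mul addr0.
Qed.

Lemma evv_add u v : evv (addv u v) = evv u + evv v.
Proof.
case: u v => [[u0 u1] u2] [[v0 v1] v2].
by apply/matrixP => -[[|[|[|//]]] hi] j; rewrite !mxE /= ev_add.
Qed.

Lemma evv_mulvm u M : (evv (mulvm u M))^T = (evv u)^T *m evm M.
Proof. by rewrite evv_mulmv evm_tr trmx_mul trmxK. Qed.

Lemma evm_mul M N : evm (mulm M N) = evm M *m evm N.
Proof.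
case: M N => [[[[a00 a01] a02] [[a10 a11] a12]] [[a20 a21] a22]]
  [[[[b00 b01] b02] [[b10 b11] b12]] [[b20 b21] b22]].
apply/matrixP => -[[|[|[|i]]] hi] [[|[|[|j]]] hj] //;
  by rewrite !mxE !big_ord_recl big_ord0 !mxE /= !ev_add !ev_mul addr0;
    congr (_ + (_ + _)); rewrite mulrC.
Qed.

Lemma evm_scale k M : evm (scalem k M) = zr R k *: evm M.
Proof.
case: M => [[[[a00 a01] a02] [[a10 a11] a12]] [[a20 a21] a22]].
by apply/matrixP => -[[|[|[|i]]] hi] [[|[|[|j]]] hj]; rewrite !mxE //= ev_scale.
Qed.

Lemma det_mx3 a00 a01 a02 a10 a11 a12 a20 a21 a22 :
  \det (mx3 [:: [:: a00; a01; a02]; [:: a10; a11; a12]; [:: a20; a21; a22]]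
         : 'M[R]_3)
   = a00 * (a11 * a22 - a12 * a21) - a01 * (a10 * a22 - a12 * a20)
     + a02 * (a10 * a21 - a11 * a20).
Proof.
rewrite (expand_det_row _ ord0) !big_ord_recl big_ord0 /cofactor.
rewrite !(expand_det_row _ (ord0 : 'I_2)) !big_ord_recl !big_ord0 /cofactor.
rewrite !det_mx11.
rewrite !mxE /=. ring.
Qed.
End EvMat.

(** * The icosahedral group in coordinates dual to the simple roots *)

Local Notation "# k" := (xconst k%bZ)
  (at level 8, k constr at level 0, format "# k").

(** The rows are normal vectors of the mirrors of R0, R1 and R2, scaled to
    length 2 and pairwise at obtuse or right angles: the simple roots of H3.
    The product of this matrix with a vector lists its scalar products with
    the simple roots, and R_j adds to these multiples of the j-th one, by
    -2, 0, 1 or phi. *)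
Definition simple_roots : mat :=
  ((#2, #0, #0), (xscale (-1)%bZ tau, #(-1), xsub #1 tau), (#0, #2, #0)).

Definition onem : mat := ((#1, #0, #0), (#0, #1, #0), (#0, #0, #1)).
Definition refl0 : mat := ((#(-1), #0, #0), (tau, #1, #0), (#0, #0, #1)).
Definition refl1 : mat := ((#1, tau, #0), (#0, #(-1), #0), (#0, #1, #1)).
Definition refl2 : mat := ((#1, #0, #0), (#0, #1, #1), (#0, #0, #(-1))).

Definition rot5 := mulm refl0 refl1.
Definition rot5i := mulm refl1 refl0.
Definition rot3 := mulm refl1 refl2.
Definition rot3i := mulm refl2 refl1.
Definition rot2 := mulm refl0 refl2.

Definition pow5 := [:: onem; rot5; mulm rot5 rot5; mulm rot5i rot5i; rot5i].

(** The half turn that exchanges the two poles of the axis of rot5, as a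
    conjugate of rot2. *)
Definition flip :=
  let g := mulm rot2 (mulm rot5 rot5) in
  let gi := mulm (mulm rot5i rot5i) rot2 in mulm g (mulm rot2 gi).

(** The ten rotations rot5^i * flip^e preserve the axis of rot5, and the
    rot5^i * rot2 carry it to the five other axes of order 5.  So each element
    of I is, in one way, either rot5^i * flip^e or
    rot5^i * rot2 * rot5^j * flip^e. *)
Definition rots : seq mat :=
  [seq mulm q e
    | q <- [seq mulm p x | p <- pow5, x <- onem :: [seq mulm rot2 p | p <- pow5]],
      e <- [:: onem; flip]].

Section RootCoordinates.
Variable R : realType.
Local Notation ev := (ev R).
Local Notation evm := (@evm R).
Local Notation C := (evm simple_roots).

Lemma evm1 : evm onem = 1%:M.
Proof.
by apply/matrixP => -[[|[|[|i]]] hi] [[|[|[|j]]] hj] //; rewrite !mxE //= ev_const.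
Qed.

Lemma simple_roots_unit : C \in unitmx.
Proof.
(* The adjugate matrix; d is the determinant. *)
pose adj : mat := ((xscale 2%bZ (xsub tau #1), #0, #0),
  (#0, #0, xscale 2%bZ (xsub tau #1)), (xscale (-2)%bZ tau, #(-4), #(-2))).
pose d := xscale 4%bZ (xsub tau #1).
have E : mulm adj simple_roots = ((d, #0, #0), (#0, d, #0), (#0, #0, d)) by vm_compute.
have d0 : 0 < ev d by exact: ev_gt0.
have Ed : evm ((d, #0, #0), (#0, d, #0), (#0, #0, d)) = (ev d)%:M.
  by apply/matrixP => -[[|[|[|i]]] hi] [[|[|[|j]]] hj] //; rewrite !mxE //= ev_const.
have := evm_mul R adj simple_roots; rewrite E Ed.
move/(congr1 (fun X => (ev d)^-1 *: X)).
rewrite scale_scalar_mx mulVf ?lt0r_neq0 // scalemxAl => /esym/mulmx1_unit.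
by case.
Qed.

Definition evr (M : mat) : 'M[R]_3 := invmx C *m evm M *m C.

Lemma evr_mul M N : evr (mulm M N) = evr M *m evr N.
Proof. by rewrite /evr evm_mul !mulmxA mulmxK ?simple_roots_unit. Qed.

Lemma evr1 : evr onem = 1%:M.
Proof. by rewrite /evr evm1 mulmx1 mulVmx ?simple_roots_unit. Qed.

Lemma mul_simple_roots_evr M : C *m evr M = evm M *m C.
Proof. by rewrite /evr !mulmxA mulmxV ?simple_roots_unit // mul1mx. Qed.

Lemma evr_eq (A : 'M[R]_3) M : C *m A = evm M *m C -> A = evr M.
Proof. by move=> E; rewrite /evr -mulmxA -E mulKmx ?simple_roots_unit. Qed.

Lemma R0E : R0 R = evr refl0.
Proof.
pose M : mat := ((#(-1), #0, #0), (#0, #1, #0), (#0, #0, #1)).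
have -> : R0 R = evm M.
  by apply/matrixP => -[[|[|[|i]]] hi] [[|[|[|j]]] hj] //; rewrite !mxE //= ev_const.
by apply: evr_eq; rewrite -!evm_mul; congr evm; vm_compute.
Qed.

Lemma R2E : R2 R = evr refl2.
Proof.
pose M : mat := ((#1, #0, #0), (#0, #(-1), #0), (#0, #0, #1)).
have -> : R2 R = evm M.
  by apply/matrixP => -[[|[|[|i]]] hi] [[|[|[|j]]] hj] //; rewrite !mxE //= ev_const.
by apply: evr_eq; rewrite -!evm_mul; congr evm; vm_compute.
Qed.

Lemma R1E : R1 R = evr refl1.
Proof.
pose M : mat := ((xsub #1 tau, xscale (-1)%bZ tau, #(-1)),
  (xscale (-1)%bZ tau, #1, xsub #1 tau), (#(-1), xsub #1 tau, tau)).
have z1 : zr R 1 = 1 by [].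
have zN1 : zr R (-1) = -1 by [].
have -> : R1 R = 2^-1 *: evm M.
  rewrite /R1; congr (_ *: _).
  apply/matrixP => -[[|[|[|i]]] hi] [[|[|[|j]]] hj] //; rewrite !mxE //=;
    by rewrite ?phiE -?/tau ?ev_sub ?ev_scale ?ev_const ?z1 ?zN1 ?mulN1r.
apply: evr_eq; rewrite -scalemxAr -!evm_mul.
have -> : mulm simple_roots M = scalem 2 (mulm refl1 simple_roots) by vm_compute.
by rewrite evm_scale scalerA (_ : zr R 2 = 2) // mulVf ?scale1r // pnatr_eq0.
Qed.

Lemma det_R0 : \det (R0 R) = -1. Proof. by rewrite det_mx3; ring. Qed.
Lemma det_R2 : \det (R2 R) = -1. Proof. by rewrite det_mx3; ring. Qed.
Lemma det_R1 : \det (R1 R) = -1.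
Proof.
have z1 : zr R 1 = 1 by [].
have zN1 : zr R (-1) = -1 by [].
have z0 : zr R 0 = 0 by [].
rewrite R1E /evr !det_mulmx mulrAC -det_mulmx mulVmx ?simple_roots_unit //.
by rewrite det1 mul1r det_mx3 !ev_const z1 zN1 z0; ring.
Qed.

End RootCoordinates.

(** * The sixty rotations *)

Section RotationList.
Variable R : realType.
Local Notation evr := (@evr R).

Lemma evr_rotM M N : rotI_set (evr M) -> rotI_set (evr N) ->
  rotI_set (evr (mulm M N)).
Proof.
move=> [IM dM] [IN dN]; rewrite evr_mul; split; first exact: Ih_mul.
by rewrite /= det_mulmx dM dN mulr1.
Qed.

Lemma refl_rotM M N : Ih (evr M) -> \det (evr M) = -1 ->
    Ih (evr N) -> \det (evr N) = -1 ->
  rotI_set (evr (mulm M N)).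
Proof.
move=> IM dM IN dN; rewrite evr_mul; split; first exact: Ih_mul.
by rewrite /= det_mulmx dM dN mulrNN mulr1.
Qed.

Lemma rots_rotI M : M \in rots -> rotI_set (evr M).
Proof.
have I0 := Ih_R0 R; have I1 := Ih_R1 R; have I2 := Ih_R2 R.
have d0 := det_R0 R; have d1 := det_R1 R; have d2 := det_R2 R.
rewrite R0E in I0 d0; rewrite R1E in I1 d1; rewrite R2E in I2 d2.
have r5 : rotI_set (evr rot5) by exact: refl_rotM.
have r5i : rotI_set (evr rot5i) by exact: refl_rotM.
have r2 : rotI_set (evr rot2) by exact: refl_rotM.
have r1 : rotI_set (evr onem) by rewrite evr1; split; [exact: Ih_one|exact: det1].
have r55 := evr_rotM r5 r5; have r55i := evr_rotM r5i r5i.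
have rf : rotI_set (evr flip) :=
  evr_rotM (evr_rotM r2 r55) (evr_rotM r2 (evr_rotM r55i r2)).
have pow5P p : p \in pow5 -> rotI_set (evr p).
  by rewrite !inE => /orP[|/orP[|/orP[|/orP[]]]] /eqP ->.
case/allpairsP => -[q e] [] /allpairsP[[p x] [/pow5P gp]].
rewrite in_cons => xP -> [eP ->]; apply: evr_rotM.
  apply: evr_rotM => //; case/predU1P: xP => [-> // | /mapP [y yP ->]].
  by apply: evr_rotM => //; exact: pow5P.
by move: eP; rewrite in_cons mem_seq1 => /predU1P[->|/eqP ->].
Qed.

(** A reflection has determinant -1, hence it exchanges the list and its
    negative. *)
Lemma rots_reflP :
  all (fun M => all (fun s => scalem (-1) (mulm M s) \in rots)
    [:: refl0; refl1; refl2]) rots.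
Proof. by vm_compute. Qed.

Definition signed_rot (A : 'M[R]_3) : Prop :=
  exists M, M \in rots /\ (A = evr M \/ A = - evr M).

Lemma evr_opp M : evr (scalem (-1) M) = - evr M.
Proof. by rewrite /evr evm_scale scaleN1r mulmxN mulNmx. Qed.

Lemma signed_rot_refl s X : s \in [:: refl0; refl1; refl2] -> signed_rot X ->
  signed_rot (X *m evr s).
Proof.
move=> sP [M [MP XE]].
have /allP/(_ _ MP)/allP/(_ _ sP) Ms := rots_reflP.
exists (scalem (-1) (mulm M s)); split => //; rewrite evr_opp evr_mul opprK.
by case: XE => ->; rewrite ?mulNmx; [right|left].
Qed.

(** Right multiplication by a generator preserves the set of signed rotations,
    and so does its inverse, the generators being involutions.  This property
    passes to products and inverses, hence to the whole group, which is the
    image of the identity. *)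
Lemma Ih_signed_rot A : Ih A -> signed_rot A.
Proof.
pose good A := A \in unitmx /\
  forall X, signed_rot X -> signed_rot (X *m A) /\ signed_rot (X *m invmx A).
have refl_good s : s \in [:: refl0; refl1; refl2] -> good (evr s).
  move=> sP; have ss : mulm s s = onem.
    by move: sP; rewrite !inE => /or3P[] /eqP ->; vm_compute.
  have EE : evr s *m evr s = 1%:M by rewrite -evr_mul ss evr1.
  have [uA _] := mulmx1_unit EE; split=> // X /(signed_rot_refl sP) Xs.
  by rewrite -[invmx _]mulmx1 -EE mulKmx.
suff : Ih A -> good A.
  move=> gA /gA [_ /(_ 1%:M)]; rewrite mul1mx => -[] //.
  by exists onem; split; [by vm_compute|left; rewrite evr1].
elim=> {A} [|||||A IA [uA hA]].
- by rewrite R0E; apply: refl_good; rewrite !inE eqxx.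
- by rewrite R1E; apply: refl_good; rewrite !inE eqxx orbT.
- by rewrite R2E; apply: refl_good; rewrite !inE eqxx !orbT.
- by split=> [|X]; rewrite ?unitmx1 // invmx1 mulmx1.
- move=> A B _ [uA hA] _ [uB hB]; split=> [|X Xs]; first by rewrite unitmx_mul uA.
  have -> : invmx (A *m B) = invmx B *m invmx A := invrM uA uB.
  rewrite !mulmxA; split.
    by apply: (hB _ _).1; apply: (hA _ _).1.
  by apply: (hA _ _).2; apply: (hB _ _).2.
- split=> [|X /hA[? ?]]; first by rewrite unitmx_inv.
  by rewrite invmxK.
Qed.

(** The determinant selects the sign. *)
Lemma rotI_rots (A : rotI R) : exists2 M, M \in rots & val A = evr M.
Proof.
case: (set_valP A) => /Ih_signed_rot [M [MP AE]] detA; exists M => //.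
case: AE => // AE; have [_ /= detM] := rots_rotI MP.
exfalso; move: detA; rewrite /= AE -scaleN1r detZ detM mulr1.
by rewrite !exprS expr0 {AE} => ?; lra.
Qed.
End RotationList.

(** * The rotations as a finite group, and their orders *)

Section RotIFinite.
Variable R : realType.
Local Notation evr := (@evr R).

Definition rotI_seq : seq (rotI R) := undup (pmap insub (map evr rots)).

Lemma mem_rotI_seq A : A \in rotI_seq.
Proof.
rewrite mem_undup mem_pmap_sub; have [M MP AE] := rotI_rots A.
by apply/mapP; exists M.
Qed.

Fact rotI_pickleK : cancel (fun A => index A rotI_seq) (nth 1%g rotI_seq).
Proof. by move=> A; rewrite nth_index ?mem_rotI_seq. Qed.

Fact rotI_enumP : Finite.axiom rotI_seq.
Proof. by move=> A; rewrite count_uniq_mem ?undup_uniq // mem_rotI_seq. Qed.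
End RotIFinite.

HB.instance Definition _ (R : realType) :=
  Countable.copy (rotI R) (can_type (@rotI_pickleK R)).
HB.instance Definition _ (R : realType) := isFinite.Build (rotI R) (@rotI_enumP R).

Section RotICount.
Variable R : realType.
Local Notation evr := (@evr R).

(** Distinct elements of Z[xi] are told apart by the sign of their difference:
    this spares a proof that the powers of xi are independent over Q. *)
Definition zxi_sep (x y : zxi) := xpos (xsub x y) || xpos (xsub y x).
Definition mat_sep (M N : mat) : bool :=
  let '(r0, r1, r2) := M in let '(s0, s1, s2) := N in
  let sv u v := let '(u0, u1, u2) := u in let '(v0, v1, v2) := v in
    [|| zxi_sep u0 v0, zxi_sep u1 v1 | zxi_sep u2 v2] in
  [|| sv r0 s0, sv r1 s1 | sv r2 s2].

Lemma zxi_sep_neq x y : zxi_sep x y -> ev R x != ev R y.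
Proof.
by case/orP => /(ev_gt0 R); rewrite ev_sub subr_gt0 => h;
  rewrite ?(gt_eqF h) ?(lt_eqF h).
Qed.

Lemma mat_sep_neq M N : mat_sep M N -> evr M != evr N.
Proof.
move=> MN; apply: contraTneq MN => E.
have {}E : evm R M = evm R N.
  have := congr1 (mulmx (evm R simple_roots)) E; rewrite !mul_simple_roots_evr.
  move/(congr1 (mulmx^~ (invmx (evm R simple_roots)))).
  by rewrite !mulmxK ?simple_roots_unit.
case: M N E => [[[[a00 a01] a02] [[a10 a11] a12]] [[a20 a21] a22]]
  [[[[b00 b01] b02] [[b10 b11] b12]] [[b20 b21] b22]] E.
have h (i j : nat) (i3 : (i < 3)%N) (j3 : (j < 3)%N) :=
  congr1 (fun X : 'M[R]_3 => X (Ordinal i3) (Ordinal j3)) E.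
move: (h 0%N 0%N isT isT) (h 0%N 1%N isT isT) (h 0%N 2%N isT isT)
  (h 1%N 0%N isT isT) (h 1%N 1%N isT isT) (h 1%N 2%N isT isT)
  (h 2%N 0%N isT isT) (h 2%N 1%N isT isT) (h 2%N 2%N isT isT).
rewrite !mxE /= => *; apply/negP; rewrite /mat_sep.
by move=> /or3P[] /or3P[] /zxi_sep_neq /eqP.
Qed.

Lemma uniq_evr_rots : uniq (map evr rots).
Proof.
rewrite uniq_pairwise pairwise_map.
apply: (@sub_pairwise _ mat_sep); first by move=> M N; exact: mat_sep_neq.
by vm_compute.
Qed.

Definition rot_of_code (M : mat) (MP : M \in rots) : rotI R :=
  SigSub (mem_set (rots_rotI R MP)).

Lemma perm_rotI : perm_eq (map val (index_enum {: rotI R})) (map evr rots).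
Proof.
apply: uniq_perm; [|exact: uniq_evr_rots|move=> X].
  by rewrite map_inj_uniq; [exact: index_enum_uniq|exact: val_inj].
apply/mapP/mapP => [[A _ ->]|[M MP ->]].
  by have [M MP ->] := rotI_rots A; exists M.
have mA : rot_of_code MP \in index_enum {: rotI R} by rewrite mem_index_enum.
by exists (rot_of_code MP).
Qed.

Lemma card_rotI : #|{: rotI R}| = 60.
Proof.
rewrite cardE enumT -(size_map val) (perm_size perm_rotI) size_map.
by vm_compute.
Qed.

Lemma sum_rotI (f : rotI R -> nat) (g : mat -> nat) :
    (forall A M, M \in rots -> val A = evr M -> f A = g M) ->
  (\sum_(A : rotI R) f A = \sum_(M <- rots) g M)%N.
Proof.
(* A function of the matrix alone, which finds the code again. *)
move=> fg; pose h X := g (nth onem rots (index X (map evr rots))).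
have fh A : f A = h (val A).
  have [M MP AE] := rotI_rots A.
  have lt_A : (index (val A) (map evr rots) < size rots)%N.
    by rewrite -(size_map evr) index_mem AE map_f.
  apply: fg; first by rewrite mem_nth.
  by rewrite -(nth_map _ (evr onem)) // nth_index // AE map_f.
transitivity (\sum_(X <- map evr rots) h X)%N.
  rewrite -(perm_big _ perm_rotI) /= big_map.
  by apply: eq_bigr => A _; exact: fh.
rewrite big_map; apply: eq_big_seq => M MP.
by rewrite -(fg (rot_of_code MP) M) // fh.
Qed.

(** The order of a rotation, given that it is 1, 2, 3 or 5. *)
Definition ordm (M : mat) : nat :=
  if M == onem then 1 else if mulm M M == onem then 2 else
  if mulm M (mulm M M) == onem then 3 else 5.

Lemma mat_sep_onem : all (fun M => (M != onem) ==> mat_sep M onem) rots.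
Proof. by vm_compute. Qed.

Lemma ordm_ok : all (fun M => iter (ordm M) (mulm M) onem == onem) rots.
Proof. by vm_compute. Qed.

Lemma order_rotI (A : rotI R) M : M \in rots -> val A = evr M -> #[A]%g = ordm M.
Proof.
move=> MP AE.
have MX n : val (A ^+ n)%g = evr (iter n (mulm M) onem).
  by elim: n => [|n IHn]; rewrite ?evr1 // expgS /= evr_mul -IHn -AE.
have eq1 : (A == 1%g) = (M == onem).
  rewrite -val_eqE AE /= -evr1; apply/eqP/eqP => [E|-> //].
  apply: contraTeq isT => M1; suff /mat_sep_neq : mat_sep M onem by rewrite E eqxx.
  by have /allP/(_ M MP)/implyP/(_ M1) := mat_sep_onem.
have order_prime p : prime p -> M != onem -> iter p (mulm M) onem = onem ->
    #[A]%g = p.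
  move=> p_pr; rewrite -eq1 => A1 Mp; apply: nt_prime_order => //.
  by apply: val_inj; rewrite MX Mp evr1.
have /allP/(_ M MP) := ordm_ok.
rewrite /ordm; case: (eqVneq M onem) => [M1 _|M1 /eqP].
  by move: eq1; rewrite M1 eqxx => /eqP ->; rewrite order1.
by case: ifP => _ => [|]; last case: ifP => _; move=> Mp; apply: order_prime.
Qed.

Lemma sum_rots_ordm t :
  (\sum_(M <- rots) t ^ (60 %/ ordm M)
    = t ^ 60 + 24 * t ^ 12 + 20 * t ^ 20 + 15 * t ^ 30)%N.
Proof.
rewrite -(big_map (fun M => 60 %/ ordm M)%N xpredT (fun k => t ^ k)%N).
have E : perm_eq [seq (60 %/ ordm M)%N | M <- rots]
    ([:: 60] ++ nseq 24 12 ++ nseq 20 20 ++ nseq 15 30) by vm_compute.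
rewrite (perm_big _ E) !big_cat !big_nseq !iter_addn_0 /= big_seq1.
by move: (t ^ 60)%N (t ^ 12)%N (t ^ 20)%N (t ^ 30)%N => *; lia.
Qed.

Lemma sum_order_rotI t :
  (\sum_(A : rotI R) t ^ (#|{: rotI R}| %/ #[A]%g)
    = t ^ 60 + 24 * t ^ 12 + 20 * t ^ 20 + 15 * t ^ 30)%N.
Proof.
rewrite card_rotI -sum_rots_ordm; apply: sum_rotI => A M MP AE.
by rewrite (order_rotI MP AE).
Qed.
End RotICount.

(** * A face and its neighbours *)

Definition vec0 : vec := (#0, #0, #0).

(** The face chosen here has its vertex of order 3 on the axis of rot3, and its
    vertex of order 5 on the axis of rot5: in coordinates dual to the simple
    roots these axes are coordinate axes.  The remaining vertices form the
    orbit of (beta1, beta2, beta3), and vertb is the one adjacent to both. *)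
Definition vert3 : vec := (xscale 2%bZ (xsub tau #1), #0, #0).

(** This is 31 times the vertex. *)
Definition vert5 : vec := (#0, #0, xscale 2%bZ alpha31).

Definition vertb : vec :=
  ((4, -4, -2, 2, 0, 0), (-4, 8, 6, -8, -2, 2), (2, -4, -10, 6, 4, -2))%bZ.

(** The linear form that is constant on the face, determined up to a factor by
    three of the vertices; the factor is chosen for small coefficients. *)
Definition face_normal : vec :=
  ((0, 1, 0, 0, 0, 0), (2, 0, 0, 0, 0, 0), (-2, 0, 4, 0, -1, 0))%bZ.

Definition face_height : zxi := (0, -2, -4, 0, 2, 0)%bZ.

(** Rotations that carry (1, 1, 1) and alpha (0, 1, phi), respectively
    (beta1, beta2, beta3), to vertices of the face. *)
Definition to35 : mat := mulm rot2 (mulm (mulm rot5i rot5i) (mulm rot3i rot5)).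
Definition tob : mat := mulm rot3 (mulm (mulm rot5i rot5i) rot3i).

Definition xnonneg (x : zxi) := (x == #0) || xpos x.

(** The vertices in cyclic order, each preceded by the integer by which it has
    been multiplied to clear denominators. *)
Definition face_verts : seq (Z * vec) :=
  [:: (31%bZ, vert5); (1%bZ, vertb); (1%bZ, vert3);
      (1%bZ, mulmv rot3i vertb); (1%bZ, mulmv rot5 vertb)].

Definition orbit_verts : seq (Z * vec) :=
  [:: (31%bZ, vert5); (1%bZ, vertb); (1%bZ, vert3)].

Lemma vertices_below :
  all (fun M => all (fun kv => xnonneg
    (xsub (xscale kv.1 face_height) (dot face_normal (mulmv M kv.2))))
    orbit_verts) rots.
Proof. by vm_compute. Qed.

(** The three vertices together, with their multiplicities 31, 1 and 1, have
    height 33 c.  They cannot keep it under a rotation other than the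
    identity. *)
Lemma face_not_fixed :
  all (fun M => (M == onem) ||
    xpos (xsub (xscale 33 face_height)
      (dot face_normal (mulmv M (addv vert5 (addv vertb vert3)))))) rots.
Proof. by vm_compute. Qed.

Lemma face_on_plane :
  all (fun kv => dot face_normal kv.2 == xscale kv.1 face_height) face_verts.
Proof. by vm_compute. Qed.

Definition fvert i : vec := (nth (1%bZ, vec0) face_verts i).2.

(** The rotation M carries the face to the neighbour across the edge from vertex
    i to vertex j, or back from it: the form n - n M vanishes on this edge, so
    it is a positive multiple of the side of the cone spanned by i and j.  The
    factor is the quotient of the values at any third vertex k. *)
Definition edge_ok (i j k : nat) (M : mat) : bool :=
  let e := cross (fvert i) (fvert j) in
  let d := subv face_normal (mulvm face_normal M) in
  let s := dot e (fvert k) in let t := dot d (fvert k) in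
  [&& xpos s, xpos t & scalev t e == scalev s d].

Lemma edges_ok : [&& edge_ok 0 1 2 rot5, edge_ok 1 2 3 rot3i, edge_ok 2 3 4 rot3,
  edge_ok 3 4 0 rot2 & edge_ok 4 0 1 rot5i].
Proof. by vm_compute. Qed.

(** The three triangles that fan out from the first vertex have the same
    orientation. *)
Lemma fans_ok : [&& xpos (dot (cross (fvert 0) (fvert 1)) (fvert 2)),
  xpos (dot (cross (fvert 0) (fvert 2)) (fvert 3))
  & xpos (dot (cross (fvert 0) (fvert 3)) (fvert 4))].
Proof. by vm_compute. Qed.

Lemma reps_ok : [&& mulmv to35 (mulmv simple_roots (#1, #1, #1)) == vert3,
  mulmv to35 (mulmv simple_roots (#0, alpha31, xmul alpha31 tau)) == vert5,
  mulmv tob (mulmv simple_roots ((0, 1, 0, 0, 0, 0), (0, 5, 2, -7, -1, 2),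
    (-1, 2, -2, -1, 1, 0))%bZ) == vertb,
  to35 \in rots & tob \in rots].
Proof. by vm_compute. Qed.

Lemma rots_words : [/\ rot5 \in rots, rot5i \in rots, rot3 \in rots,
  rot3i \in rots & rot2 \in rots].
Proof. by split; vm_compute. Qed.

Lemma flip_ok : flip \in rots /\ mulmv flip vert5 = scalev #(-1) vert5.
Proof. by split; vm_compute. Qed.

(** * The hull, the half-spaces of its faces, and the cone over a face *)

Section Geometry.
Variable R : realType.
Local Open Scope classical_set_scope.
Local Open Scope ring_scope.
Local Notation ev := (ev R).
Local Notation evm := (@evm R).
Local Notation evv := (@evv R).
Local Notation evr := (@evr R).
Local Notation C := (evm simple_roots).
Local Notation P := (@pentagonal_hexecontahedron R).

Definition form (u : vec) (y : 'cV[R]_3) : R := ((evv u)^T *m y) 0 0.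

(** The point with given scalar products with the simple roots. *)
Definition point (v : vec) : 'cV[R]_3 := invmx C *m evv v.

Lemma formE u v : form u (evv v) = ev (dot u v).
Proof. by rewrite /form -ev_dot. Qed.

Lemma form_mulvm u M y : form (mulvm u M) y = form u (evm M *m y).
Proof. by rewrite /form evv_mulvm mulmxA. Qed.

Lemma formD u y z : form u (y + z) = form u y + form u z.
Proof. by rewrite /form mulmxDr mxE. Qed.
Lemma formZ u a y : form u (a *: y) = a * form u y.
Proof. by rewrite /form -scalemxAr mxE. Qed.

Lemma form_coords v0 v1 v2 (y : 'cV[R]_3) :
  form (v0, v1, v2) y =
    ev v0 * y (inord 0) 0 + ev v1 * y (inord 1) 0 + ev v2 * y (inord 2) 0.
Proof.
rewrite /form !mxE !big_ord_recl big_ord0 !mxE /= addr0 addrA.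
by congr (_ * y _ 0 + _ * y _ 0 + _ * y _ 0); apply/val_inj; rewrite /= inordK.
Qed.

Lemma form_scalev k v y : form (scalev k v) y = ev k * form v y.
Proof. by case: v => [[v0 v1] v2]; rewrite /= !form_coords !ev_mul; ring. Qed.

Lemma form_subv u v y : form (subv u v) y = form u y - form v y.
Proof.
by case: u v => [[u0 u1] u2] [[v0 v1] v2]; rewrite /= !form_coords !ev_sub; ring.
Qed.

Lemma form_crossC u v y : form (cross u v) y = - form (cross v u) y.
Proof.
case: u v => [[u0 u1] u2] [[v0 v1] v2]; rewrite /= !form_coords !ev_sub !ev_mul.
by ring.
Qed.

Lemma cramer p q r y :
  ev (dot (cross p q) r) *: y = form (cross q r) y *: evv p
    + form (cross r p) y *: evv q + form (cross p q) y *: evv r.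
Proof.
case: p q r => [[p0 p1] p2] [[q0 q1] q2] [[r0 r1] r2].
have E i (i3 : (i < 3)%N) : Ordinal i3 = inord i by apply/val_inj; rewrite /= inordK.
apply/matrixP => -[[|[|[|i]]] hi] j //; rewrite ord1 !mxE /= !form_coords E
  !(ev_add, ev_sub, ev_mul); ring.
Qed.

Definition hgt (x : 'cV[R]_3) : R := form face_normal (C *m x).
Local Notation c := (ev face_height).

Lemma hgtD x y : hgt (x + y) = hgt x + hgt y.
Proof. by rewrite /hgt mulmxDr formD. Qed.
Lemma hgtZ a x : hgt (a *: x) = a * hgt x.
Proof. by rewrite /hgt -scalemxAr formZ. Qed.
Lemma hgt_evr M x : hgt (evr M *m x) = form (mulvm face_normal M) (C *m x).
Proof. by rewrite /hgt mulmxA mul_simple_roots_evr -mulmxA form_mulvm. Qed.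
Lemma hgt_point v : hgt (point v) = ev (dot face_normal v).
Proof. by rewrite /hgt /point mulKVmx ?simple_roots_unit // formE. Qed.
Lemma evr_point M v : evr M *m point v = point (mulmv M v).
Proof. by rewrite /evr /point -!mulmxA mulKVmx ?simple_roots_unit // evv_mulmv. Qed.

Lemma face_height_gt0 : 0 < c.
Proof. exact: ev_gt0. Qed.

Definition vtx (kv : Z * vec) : 'cV[R]_3 := (zr R kv.1)^-1 *: point kv.2.

(** Maximality against the five neighbouring faces puts x on the inner side of
    the five sides of the cone over the face.  Two diagonals cut the pentagon
    into triangles; the position of x with respect to them tells in which of
    the three cones x lies, and Cramer's rule gives its coordinates there. *)
Lemma face_cone x :
    (forall A : rotI R, hgt (val A *m x) <= hgt x) ->
  exists p q r a b d, [/\ [/\ p \in face_verts, q \in face_verts & r \in face_verts],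
    [/\ 0 <= a, 0 <= b & 0 <= d] & x = a *: vtx p + b *: vtx q + d *: vtx r].
Proof.
move=> top.
have edge i j k M : edge_ok i j k M -> M \in rots ->
    0 <= form (cross (fvert i) (fvert j)) (C *m x).
  move=> /and3P[/(ev_gt0 R) s0 /(ev_gt0 R) t0 /eqP E] MP.
  have := congr1 (form^~ (C *m x)) E; rewrite !form_scalev form_subv -hgt_evr.
  have := top (rot_of_code R MP); rewrite -subr_ge0 => /(mulr_ge0 (ltW s0)) /= h E'.
  by rewrite -(pmulr_rge0 _ t0) E'.
have [e0 e1 e2 e3 e4] : [/\ 0 <= form (cross (fvert 0) (fvert 1)) (C *m x),
    0 <= form (cross (fvert 1) (fvert 2)) (C *m x),
    0 <= form (cross (fvert 2) (fvert 3)) (C *m x),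
    0 <= form (cross (fvert 3) (fvert 4)) (C *m x)
    & 0 <= form (cross (fvert 4) (fvert 0)) (C *m x)].
  have [w5 w5i w3 w3i w2] := rots_words.
  by have /and5P[h0 h1 h2 h3 h4] := edges_ok; split;
    [exact: edge h0 w5|exact: edge h1 w3i|exact: edge h2 w3|exact: edge h3 w2
    |exact: edge h4 w5i].
have tri i j k : (i < 5)%N -> (j < 5)%N -> (k < 5)%N ->
    xpos (dot (cross (fvert i) (fvert j)) (fvert k)) ->
    0 <= form (cross (fvert j) (fvert k)) (C *m x) ->
    0 <= form (cross (fvert k) (fvert i)) (C *m x) ->
    0 <= form (cross (fvert i) (fvert j)) (C *m x) ->
  exists p q r a b d, [/\ [/\ p \in face_verts, q \in face_verts & r \in face_verts],
    [/\ 0 <= a, 0 <= b & 0 <= d] & x = a *: vtx p + b *: vtx q + d *: vtx r].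
  move=> i5 j5 k5 /(ev_gt0 R) D0 a0 b0 d0.
  pose pv := nth (1%bZ, vec0) face_verts.
  have pv_gt0 l : 0 < zr R (pv l).1.
    by apply: zr_gt0; case: l => [|[|[|[|[|[|l]]]]]].
  exists (pv i), (pv j), (pv k).
  have := cramer (fvert i) (fvert j) (fvert k) (C *m x).
  move: (ev _) D0 (form _ _) (form _ _) (form _ _) a0 b0 d0 => D D0 d b a a0 b0 d0 E.
  exists (D^-1 * a * zr R (pv i).1), (D^-1 * b * zr R (pv j).1),
    (D^-1 * d * zr R (pv k).1).
  split; first by rewrite !mem_nth.
    by rewrite !mulr_ge0 ?invr_ge0 // ltW.
  rewrite /vtx !scalerA !mulfK ?gt_eqF // -!scalerA -!scalerDr.
  rewrite -[x in LHS](mulKmx (simple_roots_unit R)).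
  rewrite -[C *m x in LHS](scalerK (lt0r_neq0 D0)) E.
  by rewrite -!scalemxAr !mulmxDr -!scalemxAr.
have /and3P[f1 f2 f3] := fans_ok.
have flip u v : form (cross u v) (C *m x) <= 0 -> 0 <= form (cross v u) (C *m x).
  by rewrite form_crossC oppr_le0.
have [d2|/ltW d2] := leP (form (cross (fvert 0) (fvert 2)) (C *m x)) 0.
  exact: (tri 0 1 2 isT isT isT f1 e1 (flip _ _ d2) e0)%N.
have [d3|/ltW d3] := leP (form (cross (fvert 0) (fvert 3)) (C *m x)) 0.
  exact: (tri 0 2 3 isT isT isT f2 e2 (flip _ _ d3) d2)%N.
exact: (tri 0 3 4 isT isT isT f3 e3 e4 d3)%N.
Qed.

Lemma hull_conv x y (l : R) : 0 <= l -> l <= 1 -> P x -> P y ->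
  P (l *: x + (1 - l) *: y).
Proof.
move=> l0 l1 Px Py Q /= [cQ VQ].
exact: set_mem (cQ _ _ (Itv01 l0 l1)
  (mem_set (Px Q (conj cQ VQ))) (mem_set (Py Q (conj cQ VQ)))).
Qed.

Lemma vertices_hull : @hexecontahedron_vertices R `<=` P.
Proof. exact: sub_gen_smallest. Qed.

Lemma rotI_orbit_rot M v : M \in rots -> rotI_orbit (evr M *m v) = rotI_orbit v.
Proof.
move=> MP; set B := rot_of_code R MP; apply/seteqP; split => x [A _ <-].
  by exists (A * B)%g => //; rewrite mulmxA.
exists (A * B^-1)%g => //; rewrite -mulmxA mulKmx //; exact: (rotI_unitmx B).
Qed.

Lemma simple_roots_col3 u0 u1 u2 :
  col3 (ev u0) (ev u1) (ev u2) = point (mulmv simple_roots (u0, u1, u2)).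
Proof. by rewrite /point evv_mulmv mulKmx ?simple_roots_unit. Qed.

Lemma hexecontahedron_verticesE : @hexecontahedron_vertices R =
  rotI_orbit (vtx (1%bZ, vert3)) `|` rotI_orbit (vtx (31%bZ, vert5))
    `|` rotI_orbit (vtx (1%bZ, vertb)).
Proof.
have /and5P[/eqP E3 /eqP E5 /eqP Eb t3 tb] := reps_ok.
have z1 : zr R 1 = 1 by [].
have z0 : zr R 0 = 0 by [].
have xiE : beta1 R = ev (0, 1, 0, 0, 0, 0)%bZ.
  by rewrite /ev z1 z0; ring.
have o3 : rotI_orbit (vtx (1%bZ, vert3)) = rotI_orbit (col3 1 1 1).
  rewrite /vtx /= z1 invr1 scale1r -E3 -evr_point (rotI_orbit_rot _ t3).
  by rewrite -simple_roots_col3 ev_const z1.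
have o5 : rotI_orbit (vtx (31%bZ, vert5)) = rotI_orbit (alpha R *: col3 0 1 (phi R)).
  rewrite /vtx /= -E5 -evr_point scalemxAr (rotI_orbit_rot _ t3).
  rewrite -simple_roots_col3 ev_const ev_mul z0 alphaE phiE -/alpha31 -/tau.
  congr rotI_orbit; move: (ev alpha31) (ev tau) (zr R 31)^-1 => a t k.
  by apply/matrixP => -[[|[|[|//]]] hi] j; rewrite !mxE /=; ring.
have ob : rotI_orbit (vtx (1%bZ, vertb)) =
    rotI_orbit (col3 (beta1 R) (beta2 R) (beta3 R)).
  rewrite /vtx /= z1 invr1 scale1r -Eb -evr_point (rotI_orbit_rot _ tb).
  by rewrite -simple_roots_col3 -xiE -beta2E -beta3E.
by rewrite o3 o5 ob.
Qed.

Lemma hull_height (A : rotI R) x : P x -> hgt (val A *m x) <= c.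
Proof.
pose H := [set y : 'cV[R]_3 | forall A : rotI R, hgt (val A *m y) <= c].
suff PH : P `<=` H by move/PH; exact.
apply: smallest_sub.
  move=> y z l /set_mem Hy /set_mem Hz; apply/mem_set => B /=.
  have -> : val B *m (convex.conv l (y : convex_lmodType _) z : 'cV[R]_3)
    = l%:num *: (val B *m y) + (1 - l%:num) *: (val B *m z).
    by rewrite /convex.conv /= mulmxDr -!scalemxAr.
  rewrite hgtD !hgtZ; have := Hy B; have := Hz B.
  have : 0 <= l%:num by []. have : l%:num <= 1 by [].
  by nra.
have below kv : kv \in orbit_verts ->
    0 < zr R kv.1 -> rotI_orbit (vtx kv) `<=` H.
  move=> kvP k0 _ [B _ <-] A0; have [M MP ME] := rotI_rots (A0 * B)%g.
  rewrite mulmxA -[val A0 *m val B]/(val (A0 * B)%g) ME /vtx -scalemxAr hgtZ.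
  rewrite evr_point hgt_point.
  have /allP/(_ _ MP)/allP/(_ _ kvP) := vertices_below.
  rewrite mulrC ler_pdivrMr // mulrC -subr_ge0 -ev_scale -ev_sub.
  by case/orP => [/eqP ->|/(ev_gt0 R)/ltW //]; rewrite ev_const.
rewrite hexecontahedron_verticesE !subUset; split; [split|]; apply: below;
  rewrite ?inE ?eqxx ?orbT //; exact: zr_gt0.
Qed.

Lemma hull_rot M x : M \in rots -> P x -> P (evr M *m x).
Proof. by move=> MP /(hexecontahedron_stable (rot_of_code R MP)). Qed.

Lemma hull_vtx kv : kv \in orbit_verts -> P (vtx kv).
Proof.
have self v : rotI_orbit v v by exists 1%g => //; rewrite mul1mx.
rewrite !inE => kvP; apply: vertices_hull; rewrite hexecontahedron_verticesE.
case/or3P: kvP => /eqP ->.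
- by left; right; exact: self.
- by right; exact: self.
- by left; left; exact: self.
Qed.

Lemma vtx_rot M kv : evr M *m vtx kv = vtx (kv.1, mulmv M kv.2).
Proof. by rewrite /vtx -scalemxAr evr_point. Qed.

Lemma hull_face_vert kv : kv \in face_verts -> P (vtx kv).
Proof.
have [w5 _ _ w3i _] := rots_words.
rewrite !inE => /orP[/eqP->|/orP[/eqP->|/orP[/eqP->|/orP[/eqP->|/eqP->]]]].
- by apply: hull_vtx; rewrite inE eqxx.
- by apply: hull_vtx; rewrite !inE eqxx orbT.
- by apply: hull_vtx; rewrite !inE eqxx !orbT.
- rewrite -(vtx_rot rot3i (1%bZ, vertb)); apply: hull_rot w3i _.
  by apply: hull_vtx; rewrite !inE eqxx orbT.
- rewrite -(vtx_rot rot5 (1%bZ, vertb)); apply: hull_rot w5 _.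
  by apply: hull_vtx; rewrite !inE eqxx orbT.
Qed.

Lemma face_scale kv : kv \in face_verts -> 0 < zr R kv.1.
Proof.
by rewrite !inE => /orP[/eqP->|/orP[/eqP->|/orP[/eqP->|/orP[/eqP->|/eqP->]]]];
  exact: zr_gt0.
Qed.

Lemma hgt_face_vert kv : kv \in face_verts -> hgt (vtx kv) = c.
Proof.
move=> kvP; have k0 := face_scale kvP.
have /allP/(_ _ kvP)/eqP E := face_on_plane.
by rewrite /vtx hgtZ hgt_point E ev_scale mulKf ?gt_eqF.
Qed.

(** The origin is the midpoint of two opposite vertices of order 5. *)
Lemma hull0 : P 0.
Proof.
have P5 : P (vtx (31%bZ, vert5)) by apply: hull_vtx; rewrite inE eqxx.
have [fP fE] := flip_ok; have := hull_rot fP P5; rewrite vtx_rot fE.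
have -> : vtx (31%bZ, scalev #(-1) vert5) = - vtx (31%bZ, vert5).
  rewrite /vtx /point -scalerN -mulmxN; congr (_ *: (_ *m _)).
  have zN1 : zr R (-1) = -1 by [].
  have EN u0 u1 u2 : evv (scalev #(-1) (u0, u1, u2)) = - evv (u0, u1, u2).
    by apply/matrixP => -[[|[|[|//]]] hi] j; rewrite !mxE /= ev_mul ev_const zN1 mulN1r.
  exact: EN.
move: (vtx _) P5 => v Pv PNv.
have h0 : 0 <= 2^-1 :> R by lra. have h1 : 2^-1 <= 1 :> R by lra.
suff <- : 2^-1 *: v + (1 - 2^-1) *: (- v) = 0 by exact: hull_conv h0 h1 Pv PNv.
have -> : 1 - 2^-1 = 2^-1 :> R by lra.
by rewrite scalerN subrr.
Qed.

Lemma hull_shrink x t : 0 <= t -> t <= 1 -> P x -> P (t *: x).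
Proof. by move=> t0 t1 Px; have := hull_conv t0 t1 Px hull0; rewrite scaler0 addr0. Qed.

Lemma hull_sub2 x y a b : P x -> P y -> 0 <= a -> 0 <= b -> a + b <= 1 ->
  P (a *: x + b *: y).
Proof.
move=> Px Py a0 b0 ab.
have [a1|a1] := eqVneq a 1.
  have -> : b = 0 by lra.
  by rewrite scale0r addr0 a1 scale1r.
have a1' : 0 < 1 - a by rewrite subr_gt0 lt_neqAle a1; lra.
have Py' : P ((b / (1 - a)) *: y).
  by apply: hull_shrink => //; rewrite ?divr_ge0 ?(ltW a1') // ler_pdivrMr //; lra.
have la1 : a <= 1 by lra.
have := hull_conv a0 la1 Px Py'.
by rewrite scalerA mulrC divfK ?gt_eqF.
Qed.

Lemma hull_sub3 x y z a b d : P x -> P y -> P z -> 0 <= a -> 0 <= b -> 0 <= d ->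
  a + b + d <= 1 -> P (a *: x + b *: y + d *: z).
Proof.
move=> Px Py Pz a0 b0 d0 abd.
have [d1|d1] := eqVneq d 1.
  have [-> ->] : a = 0 /\ b = 0 by split; lra.
  by rewrite !scale0r !add0r d1 scale1r.
have d1' : 0 < 1 - d by rewrite subr_gt0 lt_neqAle d1; lra.
have Pxy : P ((a / (1 - d)) *: x + (b / (1 - d)) *: y).
  apply: hull_sub2; rewrite ?divr_ge0 ?(ltW d1') //.
  by rewrite -mulrDl ler_pdivrMr //; lra.
have ld1 : d <= 1 by lra.
have := hull_conv d0 ld1 Pz Pxy.
rewrite scalerDr !scalerA ![(1 - d) * _]mulrC !divfK ?gt_eqF //.
by rewrite addrC.
Qed.

(** In the cone over the face, the sum of the coefficients of x on the vertices
    is its height divided by c. *)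
Lemma hull_top x :
  (forall A : rotI R, hgt (val A *m x) <= hgt x) -> hgt x <= c -> P x.
Proof.
move=> /face_cone[p [q [r [a [b [d [[pP qP rP] [a0 b0 d0] ->]]]]]]].
rewrite !hgtD (hgtZ a) (hgtZ b) (hgtZ d).
rewrite (hgt_face_vert pP) (hgt_face_vert qP) (hgt_face_vert rP).
rewrite -!mulrDl ger_pMl ?face_height_gt0 // => abd.
exact: hull_sub3 (hull_face_vert pP) (hull_face_vert qP) (hull_face_vert rP)
  a0 b0 d0 abd.
Qed.

(** The ray through x meets the boundary of the hull where the largest of the
    heights of the rotated points reaches c. *)
Lemma hull_radial x : exists A : rotI R,
  forall t, 0 <= t -> t * hgt (val A *m x) <= c -> P (t *: x).
Proof.
have [A _ Amax] :=
  @arg_maxP _ _ _ (1%g : rotI R) xpredT (fun A => hgt (val A *m x)) isT.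
exists A => t t0 tA.
have PA : P (t *: (val A *m x)).
  apply: hull_top; last by rewrite hgtZ.
  move=> B; rewrite -scalemxAr !hgtZ ler_wpM2l //.
  by have := Amax (B * A)%g isT; rewrite /= mulmxA.
have := hexecontahedron_stable A^-1%g PA.
by rewrite -scalemxAr mulKmx // rotI_unitmx.
Qed.

(** * The rotations permute the faces simply transitively *)

Definition hgt_row : 'rV[R]_3 := (evv face_normal)^T *m C.

Lemma hgt_rowE x : (hgt_row *m x) 0 0 = hgt x.
Proof. by rewrite /hgt_row -mulmxA. Qed.

Lemma hgt_row_neq0 : hgt_row != 0.
Proof.
have E := hgt_face_vert (mem_head _ _ : (31%bZ, vert5) \in face_verts).
apply/eqP => N0; have := face_height_gt0.
by rewrite -E -hgt_rowE N0 mul0mx mxE ltxx.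
Qed.

Lemma ev_cross_l u v : ev (dot (cross u v) u) = 0.
Proof.
case: u v => [[u0 u1] u2] [[v0 v1] v2].
by rewrite -formE /= form_coords !mxE !inordK //= !ev_sub !ev_mul; ring.
Qed.

Lemma ev_cross_r u v : ev (dot (cross u v) v) = 0.
Proof. by rewrite -formE form_crossC formE ev_cross_l oppr0. Qed.

Lemma ev_cross_cyc u v w : ev (dot (cross u v) w) = ev (dot (cross v w) u).
Proof.
case: u v w => [[u0 u1] u2] [[v0 v1] v2] [[w0 w1] w2].
by rewrite -!formE /= !form_coords !mxE !inordK //= !ev_sub !ev_mul; ring.
Qed.

(** The rows of L are the coordinate forms, along v and w, of the basis u, v, w:
    they form a left inverse of the matrix of the two edges. *)
Lemma rank_triangle (u v w : Z * vec) :
    zr R u.1 != 0 -> zr R v.1 != 0 -> zr R w.1 != 0 ->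
    ev (dot (cross u.2 v.2) w.2) != 0 ->
  \rank (row_mx (vtx v - vtx u) (vtx w - vtx u)) = 2%N.
Proof.
case: u v w => [k p] [l q] [m r] /= k0 l0 m0; set D := ev _ => D0.
pose lam (s : R) a : 'rV[R]_3 := (s / D) *: ((evv a)^T *m C).
have lamE s a (x : 'cV_3) : lam s a *m x = (s / D * form a (C *m x))%:M.
  by rewrite [LHS]mx11_scalar /lam -scalemxAl mxE -mulmxA.
have Cvtx (z : Z * vec) : C *m vtx z = (zr R z.1)^-1 *: evv z.2.
  by rewrite /vtx /point -scalemxAr mulKVmx ?simple_roots_unit.
have form_vtx a (y z : Z * vec) : form a (C *m (vtx y - vtx z)) =
    (zr R y.1)^-1 * ev (dot a y.2) - (zr R z.1)^-1 * ev (dot a z.2).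
  rewrite mulmxBr -scaleN1r formD !formZ !Cvtx !formZ !formE; ring.
pose L := col_mx (lam (zr R l) (cross r p)) (lam (zr R m) (cross p q)).
suff LK : L *m row_mx (vtx (l, q) - vtx (k, p)) (vtx (m, r) - vtx (k, p)) = 1%:M.
  by apply/eqP; apply/row_fullP; exists L.
rewrite mul_col_row !lamE !form_vtx /=.
rewrite ev_cross_r !ev_cross_l ev_cross_r -/D (ev_cross_cyc r p q) -/D.
rewrite !(mulr0, subrr, subr0).
have cancel (s : R) : s != 0 -> s / D * (s^-1 * D) = 1.
  by move=> s0; rewrite mulrACA mulfV // mulVf // mulr1.
by rewrite !cancel // raddf0 -scalar_mx_block.
Qed.

Definition base_face_set : set 'cV[R]_3 := P `&` [set x | hgt x = c].

Lemma base_vert_face kv : kv \in face_verts -> base_face_set (vtx kv).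
Proof. by move=> kvP; split; [exact: hull_face_vert|exact: hgt_face_vert]. Qed.

Lemma base_faceP : faces P base_face_set.
Proof.
have m5 : (31%bZ, vert5) \in face_verts by rewrite !inE eqxx.
have mb : (1%bZ, vertb) \in face_verts by rewrite !inE eqxx orbT.
have m3 : (1%bZ, vert3) \in face_verts by rewrite !inE eqxx !orbT.
split.
  exists hgt_row, c; split; first exact: hgt_row_neq0.
  - by move=> x Px; rewrite hgt_rowE; have := hull_height 1%g Px; rewrite mul1mx.
  - by apply/seteqP; split => x [Px] /= xc; split => //; move: xc; rewrite /= hgt_rowE.
exists (vtx (31%bZ, vert5)), (vtx (1%bZ, vertb)), (vtx (1%bZ, vert3)).
split; [exact: base_vert_face m5|exact: base_vert_face mb|exact: base_vert_face m3|].
have /and3P[f1 _ _] := fans_ok.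
apply: rank_triangle.
- exact: lt0r_neq0 (face_scale m5).
- exact: lt0r_neq0 (face_scale mb).
- exact: lt0r_neq0 (face_scale m3).
- exact: lt0r_neq0 (ev_gt0 R f1).
Qed.

Definition base_face : face R := SigSub (mem_set base_faceP).

(** Both rows belong to the left kernel of K, which is a line. *)
Lemma normals_proportional (m N : 'rV[R]_3) (K : 'M[R]_(3, 2)) :
  \rank K = 2%N -> m *m K = 0 -> N *m K = 0 -> N != 0 -> exists l, m = l *: N.
Proof.
move=> rK /sub_kermxP mK /sub_kermxP NK N0.
have rker : \rank (kermx K) = 1%N by rewrite mxrank_ker rK.
have rN : \rank N = 1%N by rewrite rank_rV N0.
have := mxrank_leqif_sup NK; rewrite rker rN => -[_ /esym]; rewrite eqxx => kN.
exact/sub_rVP/(submx_trans mK).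
Qed.

(** Pushing the rotated centroid z further out along its ray would leave the
    half-space m . x <= c', so z already has maximal height c; being the mean
    of three heights that are at most c, this forces p, q and r onto the plane
    of the base face, whose normal is then proportional to m. *)
Lemma face_orbit (F : face R) : exists A : rotI R, F = face_act A base_face.
Proof.
case: (set_valP F) => -[m [c' [m0 mP FE]]] [p [q [r [Fp Fq Fr rk]]]].
move: Fp Fq Fr; rewrite FE => -[Pp /= mp] [Pq /= mq] [Pr /= mr].
have mD x y : (m *m (x + y)) 0 0 = (m *m x) 0 0 + (m *m y) 0 0 by rewrite mulmxDr mxE.
have mZ a x : (m *m (a *: x)) 0 0 = a * (m *m x) 0 0 by rewrite -scalemxAr mxE.
(* The hull contains a positive multiple of every vector, here of m itself. *)
have c0 : 0 < c'.
  have [A rad] := hull_radial m^T; have c1 := face_height_gt0.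
  pose h := hgt (val A *m m^T); pose e := c / (`|h| + 1).
  have h0 : 0 < `|h| + 1 by rewrite ltr_wpDl.
  have e0 : 0 < e by rewrite divr_gt0.
  have /mP : P (e *: m^T).
    apply: rad; first exact: ltW.
    rewrite -/h /e mulrAC ler_pdivrMr // ler_wpM2l ?(ltW c1) //.
    by rewrite (le_trans (ler_norm _)) // lerDl.
  rewrite mZ; apply: lt_le_trans; rewrite mulr_gt0 //.
  have -> : (m *m m^T) 0 0 = \sum_i m 0 i ^+ 2.
    by rewrite !mxE; apply: eq_bigr => i _; rewrite mxE expr2.
  rewrite lt_def sumr_ge0 ?andbT => [|i _]; last exact: sqr_ge0.
  apply: contra m0 => /eqP/psumr_eq0P m2; apply/eqP/rowP => i; rewrite mxE.
  by apply/eqP; rewrite -sqrf_eq0 m2 // => j _; exact: sqr_ge0.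
pose z := 3^-1 *: p + (3^-1 *: q + 3^-1 *: r).
have mz : (m *m z) 0 0 = c' by rewrite /z !mD !mZ mp mq mr; lra.
have [A rad] := hull_radial z.
have hp := hull_height A Pp; have hq := hull_height A Pq; have hr := hull_height A Pr.
have hz : hgt (val A *m z) =
    3^-1 * (hgt (val A *m p) + hgt (val A *m q) + hgt (val A *m r)).
  by rewrite /z !mulmxDr -!scalemxAr !hgtD !hgtZ; lra.
have c1 := face_height_gt0.
have hzc : c <= hgt (val A *m z).
  rewrite leNgt; apply/negP => lt_zc.
  pose h := hgt (val A *m z); pose e := Num.min 1 ((c - h) / (`|h| + 1)).
  have h0 : 0 < `|h| + 1 by rewrite ltr_wpDl.
  have e0 : 0 < e by rewrite lt_min ltr01 divr_gt0 // subr_gt0.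
  have /mP : P ((1 + e) *: z).
    apply: rad; first by rewrite addr_ge0 // ltW.
    rewrite -/h mulrDl mul1r -lerBrDl.
    apply: le_trans (ler_wpM2l (ltW e0) (ler_norm h)) _.
    have : e * (`|h| + 1) <= c - h by rewrite -ler_pdivlMr // ge_min lexx orbT.
    by apply: le_trans; rewrite ler_wpM2l ?(ltW e0) // lerDl.
  by rewrite mZ mz mulrDl mul1r gerDl leNgt mulr_gt0.
have {}hp : hgt (val A *m p) = c by lra.
have {}hq : hgt (val A *m q) = c by lra.
have {}hr : hgt (val A *m r) = c by lra.
pose N := hgt_row *m val A.
have NE x : (N *m x) 0 0 = hgt (val A *m x) by rewrite -mulmxA hgt_rowE.
have N0 : N != 0.
  apply/eqP => N0; move: (NE p); rewrite N0 mul0mx mxE hp => E.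
  by move: c1; rewrite -E ltxx.
have flat (u : 'rV[R]_3) d :
    (u *m p) 0 0 = d -> (u *m q) 0 0 = d -> (u *m r) 0 0 = d ->
  u *m row_mx (q - p) (r - p) = 0.
  move=> up uq ur; rewrite mul_mx_row !mulmxBr [u *m p]mx11_scalar.
  by rewrite [u *m q]mx11_scalar [u *m r]mx11_scalar up uq ur subrr row_mx0.
have [l mE] : exists l, m = l *: N.
  apply: (normals_proportional rk); rewrite ?N0 //.
  - exact: flat mp mq mr.
  - by apply: (flat _ c); rewrite NE.
have mNE x : (m *m x) 0 0 = l * hgt (val A *m x) by rewrite mE -scalemxAl mxE NE.
have l0 : l != 0.
  by apply: contraTneq c0 => l0; rewrite -mp mNE l0 mul0r ltxx.
exists A^-1%g; apply: val_inj; rewrite /= FE.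
have c'E : c' = l * c by rewrite -mp mNE hp.
have uA := rotI_unitmx A.
apply/seteqP; split => x /=.
  move=> [Px]; rewrite mNE c'E => /(mulfI l0) xc.
  by exists (val A *m x); [split=> //; exact: hexecontahedron_stable|rewrite mulKmx].
move=> [y [Py yc] <-]; split; first by have := hexecontahedron_stable A^-1%g Py.
by rewrite mNE mulKVmx // yc c'E.
Qed.

Lemma face_act_free (A : rotI R) : face_act A base_face = base_face -> A = 1%g.
Proof.
move=> /(congr1 val) /= AF; have [M MP AE] := rotI_rots A.
apply: val_inj; rewrite AE /= -evr1; congr evr.
have /allP/(_ _ MP) := face_not_fixed.
case/orP => [/eqP //|/(ev_gt0 R)]; rewrite ev_sub ev_scale.
have on kv : kv \in face_verts -> ev (dot face_normal (mulmv M kv.2)) = zr R kv.1 * c.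
  move=> kvP; have : base_face_set (val A *m vtx kv).
    by rewrite -AF; exists (vtx kv) => //; exact: base_vert_face.
  move=> [_ /=]; rewrite AE vtx_rot /vtx hgtZ hgt_point /= => <-.
  by rewrite mulVKf // gt_eqF // face_scale.
have m5 : (31%bZ, vert5) \in face_verts by rewrite !inE eqxx.
have mb : (1%bZ, vertb) \in face_verts by rewrite !inE eqxx orbT.
have m3 : (1%bZ, vert3) \in face_verts by rewrite !inE eqxx !orbT.
have -> : ev (dot face_normal (mulmv M (addv vert5 (addv vertb vert3)))) =
    zr R 33 * c.
  have split u v : ev (dot face_normal (mulmv M (addv u v)))
      = ev (dot face_normal (mulmv M u)) + ev (dot face_normal (mulmv M v)).
    by rewrite -!formE !evv_mulmv evv_add mulmxDr formD.
  rewrite !split (on _ m5) (on _ mb) (on _ m3) /= -!mulrDl.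
  have z31 : zr R 31 = 31 by [].
  have z1 : zr R 1 = 1 by [].
  have z33 : zr R 33 = 33 by [].
  by rewrite z31 z1 z33; congr (_ * _); lra.
by rewrite subrr ltxx.
Qed.
End Geometry.

(** * Tilings under a simply transitive action *)

Section Translation.
Local Open Scope group_scope.
Variables (gT : finGroupType) (T : finType).
Implicit Types (c : {ffun gT -> T}) (A B : gT).

Definition translate c A : {ffun gT -> T} := [ffun B => c (A * B)].

Fact translate_is_action : is_action [set: gT] translate.
Proof.
apply: is_total_action => [c|c A B]; apply/ffunP => X; first by rewrite ffunE mul1g.
by rewrite !ffunE mulgA.
Qed.
Canonical translate_action := Action translate_is_action.

(** Invariance under translation by A means being constant on the right cosets of
    the subgroup generated by A. *)
Lemma card_translate_fix A :
  #|'Fix_translate_action[A]| = (#|T| ^ (#|gT| %/ #[A]))%N.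
Proof.
pose H := <[A]>; pose cosets := rcosets H [set: gT].
pose Q := {X : {set gT} | X \in cosets}.
have in_cosets B : H :* B \in cosets.
  by apply/rcosetsP; exists B; rewrite ?finset.in_setT.
pose spread (d : {ffun Q -> T}) : {ffun gT -> T} :=
  [ffun B => d (exist _ (H :* B) (in_cosets B))].
have spread_inj : injective spread.
  move=> d d' /ffunP dd'; apply/ffunP => -[X XP].
  have /rcosetsP[B _ XE] := XP; have := dd' B; rewrite !ffunE.
  by rewrite (_ : exist _ X XP = exist _ (H :* B) (in_cosets B)) //; apply: val_inj.
have -> : 'Fix_translate_action[A] = [set spread d | d : {ffun Q -> T}].
  apply/setP => c; apply/afix1P/imsetP => [cA|[d _ ->]].
    exists [ffun X : Q => c (repr (val X))] => //; apply/ffunP => B; rewrite !ffunE /=.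
    have /rcosetP[_ /cycleP[n ->] ->] := mem_repr_rcoset [group of H] B.
    elim: n => [|n IHn]; first by rewrite expg0 mul1g.
    by rewrite IHn expgS -mulgA -[in LHS]cA ffunE.
  apply/ffunP => B; rewrite !ffunE; congr (d _); apply: val_inj => /=.
  by rewrite rcosetM rcoset_id // cycle_id.
rewrite card_imset // card_ffun; congr (_ ^ _)%N.
have -> : #|{: Q}| = #|[set: gT] : H| by rewrite card_sig; apply: eq_card.
by rewrite -divgS ?subsetT //=; congr (_ %/ _)%N; exact: finset.cardsT.
Qed.

Lemma card_translate_orbits :
  (#|orbit translate_action [set: gT] @: [set: {ffun gT -> T}]| * #|gT|
    = \sum_(A : gT) #|T| ^ (#|gT| %/ #[A]))%N.
Proof.
have acts : [acts [set: gT], on [set: {ffun gT -> T}] | translate_action].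
  by apply/actsP => A _ c; rewrite !finset.in_setT.
have := Frobenius_Cauchy acts; rewrite finset.cardsT => <-.
apply: eq_big => [A|A _]; rewrite ?finset.in_setT // -card_translate_fix.
by apply: eq_card => c; rewrite finset.in_setI finset.in_setT.
Qed.
End Translation.

Section RegularTilings.
Local Open Scope group_scope.
Variables (gT : finGroupType) (F : Type) (gact : gT -> F -> F) (f0 : F).
Hypothesis gact1 : forall f, gact 1 f = f.
Hypothesis gactM : forall A B f, gact (A * B) f = gact A (gact B f).
Hypothesis gact_trans : forall f, exists A, f = gact A f0.
Hypothesis gact_free : forall A, gact A f0 = f0 -> A = 1.
Variable T : tile_designs gact.

Lemma design_tile A x : design_act A x = ((design_act A x).1, gact A x.2) :> T * F.
Proof. by rewrite [LHS]surjective_pairing design_act_over. Qed.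

Lemma tiling_act1 (tau : tiling T) : tiling_act 1 tau = tau.
Proof. by apply/funext => f; rewrite /tiling_act design_act1 /= invg1 gact1. Qed.

Lemma tiling_actM A B (tau : tiling T) :
  tiling_act (A * B) tau = tiling_act A (tiling_act B tau).
Proof.
apply/funext => f; rewrite /tiling_act design_actM invMg gactM.
set f' := gact A^-1 f; congr (design_act A _).1.
by rewrite design_tile /= -gactM mulgV gact1.
Qed.

(** The tiles of tau, all read off on the face f0. *)
Definition pattern (tau : tiling T) : {ffun gT -> T} :=
  [ffun A => tiling_act A^-1 tau f0].

Lemma design_pattern A (tau : tiling T) :
  design_act A (pattern tau A, f0) = (tau (gact A f0), gact A f0).
Proof.
rewrite ffunE -(tiling_actE A _ _ gact1 gactM) -tiling_actM.
by rewrite mulgV tiling_act1.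
Qed.

Lemma pattern_inj : injective pattern.
Proof.
move=> tau tau' E; apply/funext => f; have [A ->] := gact_trans f.
by have := design_pattern A tau; rewrite E design_pattern => -[<-].
Qed.

(** The tile on the face A f0 can be prescribed through A, which the face
    determines. *)
Lemma pattern_surj c : exists tau, pattern tau = c.
Proof.
have [move moveE] := choice gact_trans.
exists (fun f => (design_act (move f) (c (move f), f0)).1); apply/ffunP => A.
have moveA : move (gact A f0) = A.
  have : gact (A^-1 * move (gact A f0)) f0 = f0.
    by rewrite gactM -moveE -gactM mulVg gact1.
  by move/gact_free/(canRL (mulKVg _)); rewrite mulg1.
have := design_pattern A (fun f => (design_act (move f) (c (move f), f0)).1).
rewrite moveA => /(congr1 (design_act A^-1)).
rewrite -[in RHS](design_act_over A (c A, f0)) -surjective_pairing.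
by rewrite -!design_actM mulVg !design_act1 => -[].
Qed.

Lemma pattern_act A (tau : tiling T) :
  pattern (tiling_act A tau) = translate (pattern tau) A^-1.
Proof.
by apply/ffunP => B; rewrite !ffunE -tiling_actM invMg invgK.
Qed.

Lemma pattern_orbit (tau tau' : tiling T) :
  tiling_orbit tau tau' <->
  pattern tau' \in orbit (@translate_action gT T) [set: gT] (pattern tau).
Proof.
split=> [[A _ <-]|/orbitP[A _ E]].
  by rewrite pattern_act; apply/orbitP; exists A^-1; rewrite ?inE.
exists A^-1 => //; apply: pattern_inj.
by rewrite pattern_act invgK -E.
Qed.

(** The orbits of tilings are the preimages under pattern of the orbits of
    functions under translation. *)
Lemma card_regular_tiling_orbits : exists n : nat,
  (tiling_orbits T #= `I_n)%card /\
  (n * #|gT| = \sum_(A : gT) #|T| ^ (#|gT| %/ #[A]))%N.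
Proof.
pose O := orbit (@translate_action gT T) [set: gT] @: [set: {ffun gT -> T}].
exists #|O|; split; last exact: card_translate_orbits.
pose tilings (X : {set {ffun gT -> T}}) : set (tiling T) :=
  fun tau => pattern tau \in X.
have tilings_inj : injective tilings.
  move=> X Y XY; apply/setP => c; have [tau <-] := pattern_surj c.
  have E : tilings X tau = tilings Y tau by rewrite XY.
  apply/idP/idP => h; first by rewrite -[is_true _]E.
  by rewrite -[is_true _]/(tilings X tau) E.
pose f i := tilings (nth finset.set0 (enum O) i).
have -> : tiling_orbits T = (f @` `I_#|O|)%classic.
  apply/seteqP; split=> [_ [tau _ <-]|_ [i iO <-]].
    have XO : orbit (translate_action gT T) [set: gT] (pattern tau) \in O.
      by apply: imset_f; rewrite finset.in_setT.
    exists (index (orbit (translate_action gT T) [set: gT] (pattern tau)) (enum O)).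
      by rewrite /= cardE index_mem mem_enum.
    rewrite /f nth_index ?mem_enum //.
    by apply/seteqP; split=> tau' /pattern_orbit.
  have : nth finset.set0 (enum O) i \in O.
    by rewrite -mem_enum mem_nth // -cardE.
  rewrite /f => /imsetP[c _ ->]; have [tau <-] := pattern_surj c; exists tau => //.
  by apply/seteqP; split=> tau' /pattern_orbit.
apply: inj_card_eq => i j; rewrite !inE /= => iO jO /tilings_inj/eqP.
by rewrite nth_uniq ?enum_uniq -?cardE // => /eqP.
Qed.
End RegularTilings.

(** * The number of tilings *)

Local Open Scope card_scope.

Theorem theorem17 (R : realType) (T : tile_designs (@face_act R)) :
  exists n : nat,
    (tiling_orbits T #= `I_n) /\
    n%:R = 1 / 60 * (#|T|%:R ^+ 60 + 24 * #|T|%:R ^+ 12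
                     + 20 * #|T|%:R ^+ 20 + 15 * #|T|%:R ^+ 30) :> rat.
Proof.
have [n [nT]] := card_regular_tiling_orbits (@face_act1 R) (@face_actM R)
  (@face_orbit R) (@face_act_free R) T.
rewrite sum_order_rotI card_rotI => nE; exists n; split=> //; rewrite -!natrX.
move: (#|T| ^ 60)%N (#|T| ^ 12)%N (#|T| ^ 20)%N (#|T| ^ 30)%N nE => a b c d.
move=> nE; have : (n * 60)%:R = (a + 24 * b + 20 * c + 15 * d)%:R :> rat.
  by rewrite nE.
by rewrite !natrD !(natrM _ _ _); lra.
Qed.
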